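(* Let $0<Q<n$, let $E$ be an Ahlfors $Q$-regular compact subset of $\tfrac12B$ with $\operatorname{diam}(E)\le1$, where $B$ is a ball in $\mathbb{R}^n$, and let $\nu=\mathcal{H}^Q|_E$. Let $p>1$ and $0<\theta<1$ be such that $p\theta<1$. Let $\alpha\le 0$ be such that $\alpha+n-Q>0$ and $\theta<1-\tfrac{\alpha+n-Q}{p}$. Let $\mu_\alpha$ be a measure on $B$, absolutely continuous with respect to Lebesgue measure, such that $\mu_\alpha(B(x,r))\simeq r^{n+\alpha}$ whenever $x\in B$ and $0<r<2$ with $r>\operatorname{dist}(x,E)/9$, and such that $\mu_\alpha$ is doubling on $B$ and supports a $q$-Poincaré inequality on $B$ for each $q>1$. Then there exist $C\ge 1$ and a linear trace operator \[ T:N^{1,p}(B,\mu_\alpha)\to B^\theta_{p,p}(E,\nu) \] with, for all $u\in N^{1,p}(B,\mu_\alpha)$, \[ \|Tu\|_{B^\theta_{p,p}(E,\nu)}\le C\,\||\nabla u|\|_{L^p(B,\mu_\alpha)} \qquad\text{and}\qquad \|Tu\|_{L^p(E,\nu)}^p\le C\,\|u\|_{N^{1,p}(B,\mu_\alpha)}^p . \] Moreover, if $u\in N^{1,p}(B,\mu_\alpha)$ is Lipschitz continuous in a neighborhood of $E$, then $Tu=u|_E$.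
   Context: Notation: $m$ is Lebesgue measure on $\mathbb{R}^n$, $d$ the Euclidean metric, $\mathcal{H}^Q$ the $Q$-dimensional Hausdorff measure, $\tau B$ the ball concentric with $B$ with radius $\tau$ times as large, $\operatorname{rad}(B_0)$ the radius of a ball $B_0$. $F\simeq G$ means $C^{-1}G\le F\le CG$ with a constant $C\ge1$ independent of the points and radii involved. $E$ is Ahlfors $Q$-regular if $\mathcal{H}^Q(E\cap B(x,r))\simeq r^Q$ for all $x\in E$ and $0<r\le\operatorname{diam}(E)$. The measure $\mu_\alpha$ is of the form $d\mu_\alpha=\omega\,dm$ with $\omega\ge 0$ locally integrable. Weighted Sobolev space: $N^{1,p}(B,\mu_\alpha)=W^{1,p}(B,\mu_\alpha)$ consists of the functions $f\in L^p(B,\mu_\alpha)$ having a weak derivative $\nabla f:B\to\mathbb{R}^n$ with $|\nabla f|\in L^p(B,\mu_\alpha)$, with norm $\|f\|_{N^{1,p}(B,\mu_\alpha)}=\|f\|_{L^p(B,\mu_\alpha)}+\||\nabla f|\|_{L^p(B,\mu_\alpha)}$. Doubling on $B$: there is $C\ge1$ with $\mu_\alpha(B(x,2r))\le C\mu_\alpha(B(x,r))$ for all $x\in B$, $0<r\le 10$. $q$-Poincaré inequality on $B$: there is $C>1$ such that for all $f\in W^{1,q}(B,\mu_\alpha)$ and all balls $B_0$ with $B_0\cap B\neq\emptyset$ and $\operatorname{rad}(B_0)\le 10$, \[ \frac1{\mu_\alpha(B_0)}\int_{B_0}|f-f_{B_0}|\,d\mu_\alpha\le C\operatorname{rad}(B_0)\Big(\frac1{\mu_\alpha(B_0)}\int_{B_0}|\nabla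 f|^q\,d\mu_\alpha\Big)^{1/q},\qquad f_{B_0}=\frac1{\mu_\alpha(B_0)}\int_{B_0}f\,d\mu_\alpha. \] As $\mu_\alpha$ is a measure on $B$, balls are understood as intersected with $B$. Besov space: $B^\theta_{p,p}(E,\nu)$ consists of the $u\in L^p(E,\nu)$ with \[ \|u\|_{B^\theta_{p,p}(E,\nu)}^p=\int_E\int_E\frac{|u(y)-u(x)|^p}{d(x,y)^{\theta p}\,\nu(B(x,d(x,y)))}\,d\nu(y)\,d\nu(x)<\infty . \] *)

(* Defs.v *)
(* R^n is 'rV[R]_n for R : realType. *)
From HB Require Import structures.
From mathcomp Require Import all_boot all_order all_algebra.
From mathcomp Require Import all_classical all_reals all_analysis.

Set Implicit Arguments.
Unset Strict Implicit.
Unset Printing Implicit Defensive.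
Import Order.TTheory GRing.Theory Num.Theory.
Import numFieldNormedType.Exports.
Local Open Scope classical_set_scope.
Local Open Scope ring_scope.

(* The sigma-algebra on R^n generated by the coordinates (the Borel one), set
   up as the library does for n.-tuple. *)
Definition rV_display : measure_display -> measure_display.
Proof. exact. Qed.

Section measurable_rV.
Context {R : realType}.
Variable n : nat.

Definition rV_coord (i : 'I_n) (x : 'rV[R]_n) : measurableTypeR R := x ord0 i.

Let rV_set0 : g_sigma_preimage rV_coord set0.
Proof. exact: sigma_algebra0. Qed.

Let rV_setC A : g_sigma_preimage rV_coord A -> g_sigma_preimage rV_coord (~` A).
Proof. exact: sigma_algebraC. Qed.

Let rV_bigcup (F : _^nat) : (forall i, g_sigma_preimage rV_coord (F i)) ->
  g_sigma_preimage rV_coord (\bigcup_i (F i)).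
Proof. exact: sigma_algebra_bigcup. Qed.

HB.instance Definition _ :=
  @isMeasurable.Build (rV_display (R.-ocitv.-measurable).-sigma)
  'rV[R]_n (g_sigma_preimage rV_coord) rV_set0 rV_setC rV_bigcup.

End measurable_rV.

Section measurable_rV_lemmas.
Context {R : realType}.

Lemma measurable_rV_coord n (i : 'I_n) :
  measurable_fun [set: 'rV[R]_n] (rV_coord i).
Proof.
move=> _ Y mY; rewrite setTI; apply: sub_sigma_algebra => /=.
rewrite -bigcup_seq/=; exists i => /=; first by rewrite mem_index_enum.
by exists Y => //; rewrite setTI.
Qed.

Lemma measurable_fun_rV_coordP d (T : measurableType d) n (f : T -> 'rV[R]_n) :
  (forall i, measurable_fun [set: T] (rV_coord i \o f)) ->
  measurable_fun [set: T] f.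
Proof.
move=> mf.
have h : g_sigma_preimage (fun i => rV_coord i \o f) `<=` measurable.
  apply: smallest_sub; first exact: sigma_algebra_measurable.
  rewrite -bigcup_seq/= => A [i _ [B mB <-]]; exact: mf.
move=> _ A mA; apply: h.
by rewrite g_sigma_preimage_comp; exists A.
Qed.

Definition rV_cons n (p : measurableTypeR R * 'rV[R]_n) : 'rV[R]_n.+1 :=
  \row_i oapp (p.2 ord0) p.1 (unlift ord0 i).

Lemma measurable_rV_cons n : measurable_fun setT (@rV_cons n).
Proof.
apply: measurable_fun_rV_coordP => i.
case: (unliftP ord0 i) => [j|] ->.
  rewrite (_ : _ \o _ = rV_coord j \o snd); last first.
    by apply/funext => p; rewrite /= /rV_coord mxE liftK.
  by apply: measurableT_comp; [exact: measurable_rV_coord|exact: measurable_snd].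
rewrite (_ : _ \o _ = fst); first exact: measurable_fst.
by apply/funext => p; rewrite /= /rV_coord mxE unlift_none.
Qed.

End measurable_rV_lemmas.

Section lebesgue_rV.
Context {R : realType}.
Local Open Scope ereal_scope.

Section step.
Variables (n : nat) (m : {sigma_finite_measure set 'rV[R]_n -> \bar R}).

Definition lebesgue_step : set 'rV[R]_n.+1 -> \bar R :=
  pushforward (@lebesgue_measure R \x m) (@rV_cons R n).

Let step0 : lebesgue_step set0 = 0.
Proof. by rewrite /lebesgue_step /pushforward preimage_set0 measure0. Qed.

Let step_ge0 A : 0 <= lebesgue_step A.
Proof.
rewrite /lebesgue_step /pushforward.
exact: (@measure_ge0 _ _ _ (@lebesgue_measure R \x m)).
Qed.

Let step_sigma_additive : semi_sigma_additive lebesgue_step.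
Proof.
move=> F mF tF mUF; rewrite /lebesgue_step /pushforward preimage_bigcup.
have mp A : measurable A -> measurable (@rV_cons R n @^-1` A).
  by move=> mA; rewrite -[X in measurable X]setTI; exact: measurable_rV_cons.
apply: measure_semi_sigma_additive.
- by move=> k; exact: mp.
- apply/trivIsetP => /= i j _ _ ij; rewrite -preimage_setI.
  by move/trivIsetP : tF => /(_ _ _ _ _ ij) ->//; rewrite preimage_set0.
- by rewrite -preimage_bigcup; exact: mp.
Qed.

HB.instance Definition _ := isMeasure.Build _ _ _
  lebesgue_step step0 step_ge0 step_sigma_additive.

Let step_sigma_finite : sigma_finite setT lebesgue_step.
Proof.
have [F TF Foo] : sigma_finite setT (@lebesgue_measure R \x m).
  have /sigma_finiteP[F [TF ndF Foo]] := sigma_finiteT (@lebesgue_measure R).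
  have /sigma_finiteP[G [TG ndG Goo]] := sigma_finiteT m.
  exists (fun k => F k `*` G k).
    rewrite -setXTT TF TG predeqE => -[x y]; split.
      move=> [/= [k _ Fkx] [l _ Gly]]; exists (maxn k l) => //; split.
      - by move: x Fkx; exact/subsetPset/ndF/leq_maxl.
      - by move: y Gly; exact/subsetPset/ndG/leq_maxr.
    by move=> [k _ []/= ? ?]; split; exists k.
  move=> k; have [? ?] := Foo k; have [? ?] := Goo k.
  split; first exact: measurableX.
  by rewrite product_measure1E// lte_mul_pinfty// ge0_fin_numE.
pose un (x : 'rV[R]_n.+1) : measurableTypeR R * 'rV[R]_n :=
  (rV_coord ord0 x, \row_i x ord0 (lift ord0 i)).
have consK : cancel (@rV_cons R n) un.
  move=> [a v]; congr pair; first by rewrite /rV_coord mxE unlift_none.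
  by apply/rowP => i; rewrite !mxE liftK.
have mun : measurable_fun setT un.
  apply: measurable_fun_pair; first exact: measurable_rV_coord.
  apply: measurable_fun_rV_coordP => i.
  rewrite (_ : _ \o _ = rV_coord (lift ord0 i)).
    exact: measurable_rV_coord.
  by apply/funext => x; rewrite /= /rV_coord mxE.
exists (fun k => un @^-1` F k).
  by rewrite -preimage_bigcup -TF preimage_setT.
move=> k; have [mFk Fk] := Foo k; split.
  by rewrite -[X in measurable X]setTI; exact: mun.
rewrite /lebesgue_step /pushforward -comp_preimage.
by rewrite (_ : un \o _ = id)//; apply/funext => x /=; rewrite consK.
Qed.

HB.instance Definition _ := Measure_isSigmaFinite.Build _ _ _
  lebesgue_step step_sigma_finite.

End step.

(* Lebesgue measure on R^n, the n-fold product of lebesgue_measure. *)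
Fixpoint lebesgue_rV n : {sigma_finite_measure set 'rV[R]_n -> \bar R} :=
  if n is k.+1 then lebesgue_step (lebesgue_rV k)
  else \d_(0%R : 'rV[R]_0).

Lemma lebesgue_rV_box n (a b : 'rV[R]_n) :
  (forall i, a ord0 i <= b ord0 i)%R ->
  lebesgue_rV n [set x : 'rV[R]_n |
    forall i, (a ord0 i <= x ord0 i <= b ord0 i)%R] =
  (\prod_(i < n) (b ord0 i - a ord0 i))%:E.
Proof.
have mbox k (a' b' : 'rV[R]_k) :
    measurable [set x : 'rV[R]_k |
      forall i, (a' ord0 i <= x ord0 i <= b' ord0 i)%R].
  rewrite (_ : [set x : 'rV[R]_k | _] =
      \bigcap_(i in [set: 'I_k]) (rV_coord i @^-1` `[a' ord0 i, b' ord0 i])).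
    apply: fin_bigcap_measurable; first exact: finite_finset.
    move=> i _; rewrite -[X in measurable X]setTI.
    by apply: measurable_rV_coord => //; exact: measurable_itv.
  apply/seteqP; split => x /= h i => [_|]; first by rewrite /= in_itv/= h.
  by have := h i I; rewrite /= in_itv.
elim: n a b => [|n ih] a b ab.
  rewrite big_ord0 /= diracE mem_set//=; by case.
rewrite big_ord_recl /= /lebesgue_step /pushforward.
pose a' : 'rV[R]_n := \row_i a ord0 (lift ord0 i).
pose b' : 'rV[R]_n := \row_i b ord0 (lift ord0 i).
rewrite (_ : _ @^-1` _ = `[a ord0 ord0, b ord0 ord0]%classic `*`
   [set x : 'rV[R]_n |
     forall i, (a' ord0 i <= x ord0 i <= b' ord0 i)%R]); last first.
  apply/seteqP; split => -[c v] /=; rewrite in_itv/=.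
    move=> h; split; first by have := h ord0; rewrite mxE unlift_none.
    by move=> i; have := h (lift ord0 i); rewrite !mxE liftK.
  move=> [h1 h2] i; rewrite mxE; case: (unliftP ord0 i) => [j|] -> //=.
  by have := h2 j; rewrite !mxE.
rewrite product_measure1E//=; last by move: (mbox n a' b').
rewrite ih; last by move=> i; rewrite !mxE.
rewrite lebesgue_measure_itv/= lte_fin EFinM.
under eq_bigr do rewrite !mxE.
congr (_ * _).
by move: (ab ord0); rewrite le_eqVlt => /orP[/eqP ->|->//]; rewrite ltxx subrr.
Qed.

End lebesgue_rV.

(* The norm of the library on 'rV[R]_n is the sup norm; it gives the right
   topology, but metric notions have to use the Euclidean distance below. *)
Section euclidean.
Context {R : realType} {n : nat}.
Implicit Types (x y : 'rV[R]_n) (A : set 'rV[R]_n).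

Definition eucl_norm x : R := Num.sqrt (\sum_(i < n) x ord0 i ^+ 2).
Definition eucl_dist x y : R := eucl_norm (x - y).
Definition eucl_ball x (r : R) : set 'rV[R]_n := [set y | eucl_dist x y < r].

(* The maximum with 0 only matters for A = set0. *)
Definition eucl_diam A : \bar R :=
  maxe 0%E (ereal_sup [set (eucl_dist z.1 z.2)%:E | z in A `*` A]).

(* +oo when A = set0 *)
Definition eucl_dist_set x A : \bar R :=
  ereal_inf [set (eucl_dist x y)%:E | y in A].

Definition eucl_lipschitz A (u : 'rV[R]_n -> R) :=
  exists L : R, forall x y, A x -> A y -> `|u x - u y| <= L * eucl_dist x y.

End euclidean.

Section hausdorff.
Context {R : realType} {n : nat}.
Local Open Scope ereal_scope.
Implicit Types (Q : R) (A E : set 'rV[R]_n).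

Definition hausdorff_content Q (delta : R) A : \bar R :=
  ereal_inf [set \sum_(i <oo) eucl_diam (U i) `^ Q | U in
    [set U : (set 'rV[R]_n)^nat |
      A `<=` \bigcup_i U i /\ forall i, eucl_diam (U i) <= delta%:E]].

(* The Hausdorff outer measure for Q > 0, without normalizing constant. *)
Definition hausdorff Q A : \bar R :=
  ereal_sup [set hausdorff_content Q delta A | delta in [set d : R | (0 < d)%R]].

Definition ahlfors_regular Q E :=
  exists2 C : R, (1 <= C)%R & forall x (r : R),
    E x -> (0 < r)%R -> r%:E <= eucl_diam E ->
    (C^-1 * r `^ Q)%:E <= hausdorff Q (E `&` eucl_ball x r) <= (C * r `^ Q)%:E.

End hausdorff.

Section sobolev.
Context {R : realType} {n : nat}.
Implicit Types (B : set 'rV[R]_n) (f : 'rV[R]_n -> R).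
Implicit Types (g : 'rV[R]_n -> 'rV[R]_n).
Implicit Types (mu : {measure set 'rV[R]_n -> \bar R}) (p : R).

Definition locally_integrable_rV B f :=
  measurable_fun B f /\
  forall K, compact K -> K `<=` B ->
    (\int[lebesgue_rV n]_(x in K) `|f x|%:E < +oo)%E.

Definition partials (s : seq 'I_n) (phi : 'rV[R]_n -> R^o) : 'rV[R]_n -> R^o :=
  foldr (fun i (h : 'rV[R]_n -> R^o) => 'D_(delta_mx ord0 i) h) phi s.

(* C^infty functions with compact support in B *)
Definition test_function B (phi : 'rV[R]_n -> R^o) :=
  (forall s, continuous (partials s phi) /\
     forall i x, derivable (partials s phi) x (delta_mx ord0 i)) /\
  exists K, [/\ compact K, K `<=` B & forall x, ~ K x -> phi x = 0].

Definition weak_gradient B f g :=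
  [/\ locally_integrable_rV B f,
      forall i, locally_integrable_rV B (fun x => g x ord0 i)
    & forall (phi : 'rV[R]_n -> R^o) (i : 'I_n), test_function B phi ->
        \int[lebesgue_rV n]_(x in B) (f x * 'D_(delta_mx ord0 i) phi x) =
        - \int[lebesgue_rV n]_(x in B) (g x ord0 i * phi x)].

Definition Lp mu B p : set ('rV[R]_n -> R) :=
  [set f | f \_ B \in Lfun mu p%:E].

Definition Lp_norm mu B p f : \bar R := 'N[mu]_p%:E[EFin \o (f \_ B)]%E.

(* f belongs to W^{1,p}(B, mu) and g is its weak gradient *)
Definition sobolev mu B p f g :=
  [/\ Lp mu B p f, weak_gradient B f g & Lp mu B p (eucl_norm \o g)].

Definition N1p mu B p : set ('rV[R]_n -> R) :=
  [set f | exists g, sobolev mu B p f g].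

Definition N1p_norm mu B p f g : \bar R :=
  (Lp_norm mu B p f + Lp_norm mu B p (eucl_norm \o g))%E.

(* mu = omega dm on B; mu is carried by B, so that as a Borel measure on the
   ambient space it vanishes outside B. *)
Definition weighted_measure B mu :=
  exists omega : 'rV[R]_n -> R,
    [/\ forall x, 0 <= omega x, locally_integrable_rV B omega
      & forall A, measurable A ->
          mu A = (\int[lebesgue_rV n]_(x in A `&` B) (omega x)%:E)%E].

Definition doubling_on B mu :=
  exists2 C : R, 1 <= C & forall x r, B x -> 0 < r <= 10 ->
    (mu (eucl_ball x (2 * r) `&` B) <= C%:E * mu (eucl_ball x r `&` B))%E.

Definition average mu A f : R := (fine (mu A))^-1 * \int[mu]_(x in A) f x.

Definition poincare_on B mu (q : R) :=
  exists2 C : R, 1 < C & forall f g, sobolev mu B q f g ->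
    forall x r, 0 < r <= 10 -> eucl_ball x r `&` B !=set0 ->
    let B0 := eucl_ball x r `&` B in
    ((mu B0)^-1 * \int[mu]_(y in B0) `|f y - average mu B0 f|%:E <=
     (C * r)%:E *
       ((mu B0)^-1 * \int[mu]_(y in B0) (eucl_norm (g y) `^ q)%:E) `^ q^-1)%E.

(* mu (B(x, r)) ~ r^s for balls B(x, r) with r > dist(x, E) / 9 *)
Definition codim_regular B (E : set 'rV[R]_n) mu (s : R) :=
  exists2 C : R, 1 <= C & forall x r, B x -> 0 < r < 2 ->
    ((9^-1)%:E * eucl_dist_set x E < r%:E)%E ->
    ((C^-1 * r `^ s)%:E <= mu (eucl_ball x r `&` B) <= (C * r `^ s)%:E)%E.

Definition besov_norm (nu : {measure set 'rV[R]_n -> \bar R})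
    (E : set 'rV[R]_n) (p theta : R) (u : 'rV[R]_n -> R) : \bar R :=
  ((\int[nu]_(x in E) \int[nu]_(y in E)
     ((`|u y - u x| `^ p)%:E /
      ((eucl_dist x y `^ (theta * p))%:E *
         nu (eucl_ball x (eucl_dist x y))))) `^ p^-1)%E.

Definition besov (nu : {measure set 'rV[R]_n -> \bar R})
    (E : set 'rV[R]_n) (p theta : R) : set ('rV[R]_n -> R) :=
  [set u | Lp nu E p u /\ (besov_norm nu E p theta u < +oo)%E].

End sobolev.

(* Main.v *)
(* Let u_k(x) be the average of u over the ball B(x, r_k), r_k = (3/2) 2^-k, and
   Tu = lim u_k.  The p-Poincare inequality and mu(B(x, r)) ~ r^s, s = n + alpha,
   give
     |u_k(x) - u_{k+1}(x)|^p <= C r_k^(p - s) I_k(x),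
     I_k(x) = int_{B(x, r_k)} |grad u|^p dmu,
   and the same bound for |u_j(x) - u_{j+2}(y)| when d(x, y) <= 2^-j.  With
     S_j(x) = sum_{k >= j} r_k^((1 - theta) p - s) I_k(x)
   each increment with k >= j is at most C r_k^theta S_j(x)^(1/p), so the increments
   sum geometrically and
     |Tu(x) - Tu(y)|^p <= C r_j^(theta p) (S_j(x) + S_j(y)).
   By Tonelli and nu(B(z, r)) <= C r^Q, the integral of S_j against nu is at most
   C r_j^delta int |grad u|^p dmu, where delta = (1 - theta) p - s + Q is positive by
   hypothesis.  Splitting the Besov double integral according to the dyadic scale
   j of d(x, y) then leaves the geometric series sum_j r_j^delta. *)
Require Import Defs.
From HB Require Import structures.
From mathcomp Require Import all_boot all_order all_algebra finmap.
From mathcomp Require Import all_classical all_reals all_analysis.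
From mathcomp Require Import measurable_realfun ring lra.
Import Order.TTheory GRing.Theory Num.Theory.
Import numFieldNormedType.Exports.
Local Open Scope classical_set_scope.
Local Open Scope ring_scope.

Set Implicit Arguments.
Unset Strict Implicit.
Unset Printing Implicit Defensive.

(** * Euclidean metric on ['rV[R]_n] *)

(** The operator is fixed before any estimate: as a limit superior of averages it is total and
    measurable, and no gradient enters its definition. It is linear only where the averages
    converge. That happens wherever the potential at level 0 is finite, hence nu-almost everywhere
    once the integral of that potential is finite.

    The pointwise bounds live in the extended reals: at a point of infinite potential the right-hand
    side is infinite, so the double integral needs no exceptional set.

    The weights divide the available decay. A factor r_k^theta goes to the increments, which sum
    because theta > 0; the remaining exponent delta makes the potentials small at small scales.

    The L^p bound uses level 0 only: |Tu(x)|^p is at most a constant times |u_0(x)|^p + S_0(x), and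
    Hölder's inequality bounds u_0(x) by the L^p norm of u.

    Tonelli asks for sigma-finite measures: for mu this comes from level sets of the density, for nu
    from compactness of E and regularity. *)

Section euclidean_distance.
Context {R : realType} {n : nat}.
Implicit Types (x y z : 'rV[R]_n).

Lemma eucl_norm_ge0 x : 0 <= eucl_norm x.
Proof. exact: sqrtr_ge0. Qed.

Lemma sqr_eucl_norm x : eucl_norm x ^+ 2 = \sum_(i < n) x ord0 i ^+ 2.
Proof. by rewrite sqr_sqrtr// sumr_ge0// => i _; exact: sqr_ge0. Qed.

Lemma eucl_norm0 : eucl_norm (0 : 'rV[R]_n) = 0.
Proof.
by rewrite /eucl_norm big1 ?sqrtr0// => i _; rewrite mxE expr0n.
Qed.

Lemma coord_le_eucl_norm x i : `|x ord0 i| <= eucl_norm x.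
Proof.
rewrite -sqrtr_sqr ler_wsqrtr// (bigD1 i)//= lerDl sumr_ge0// => j _.
exact: sqr_ge0.
Qed.

Lemma eucl_norm_eq0 x : eucl_norm x = 0 -> x = 0.
Proof.
move=> x0; apply/rowP => i; rewrite mxE; apply/eqP; rewrite -normr_le0 -x0.
exact: coord_le_eucl_norm.
Qed.

Lemma eucl_normN x : eucl_norm (- x) = eucl_norm x.
Proof. by congr Num.sqrt; apply: eq_bigr => i _; rewrite mxE sqrrN. Qed.

(** With a and b the two norms, multiplying by a b reduces the claim to the sum over i of 0 <= (b
    x_i - a y_i)^2. This needs a b > 0, so zero norms are treated apart. *)
Lemma cauchy_schwarz x y :
  \sum_(i < n) x ord0 i * y ord0 i <= eucl_norm x * eucl_norm y.
Proof.
set a := eucl_norm x; set b := eucl_norm y.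
have [a0|a0] := eqVneq a 0.
  rewrite a0 mul0r big1// => i _.
  by rewrite (eucl_norm_eq0 a0) mxE mul0r.
have [b0|b0] := eqVneq b 0.
  rewrite b0 mulr0 big1// => i _.
  by rewrite (eucl_norm_eq0 b0) mxE mulr0.
have ab0 : 0 < a * b by rewrite mulr_gt0// lt0r ?a0 ?b0 eucl_norm_ge0.
rewrite -(ler_pM2l ab0) mulr_sumr.
have -> : a * b * (a * b) =
    2^-1 * \sum_(i < n) (b ^+ 2 * x ord0 i ^+ 2 + a ^+ 2 * y ord0 i ^+ 2).
  by rewrite big_split/= -!mulr_sumr -!sqr_eucl_norm -/a -/b; field.
rewrite mulr_sumr; apply: ler_sum => i _.
by have := sqr_ge0 (b * x ord0 i - a * y ord0 i); lra.
Qed.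

Lemma ler_eucl_normD x y : eucl_norm (x + y) <= eucl_norm x + eucl_norm y.
Proof.
rewrite -ler_sqr ?nnegrE ?addr_ge0 ?eucl_norm_ge0//.
rewrite sqr_eucl_norm sqrrD !sqr_eucl_norm.
under eq_bigr do rewrite mxE sqrrD.
rewrite 2!big_split/= lerD2r lerD2l sumrMnl.
by rewrite lerMn2r cauchy_schwarz orbT.
Qed.

Lemma eucl_dist_ge0 x y : 0 <= eucl_dist x y.
Proof. exact: eucl_norm_ge0. Qed.

Lemma eucl_distxx x : eucl_dist x x = 0.
Proof. by rewrite /eucl_dist subrr eucl_norm0. Qed.

Lemma eucl_dist_eq0 x y : eucl_dist x y = 0 -> x = y.
Proof. by move=> /eucl_norm_eq0/eqP; rewrite subr_eq0 => /eqP. Qed.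

Lemma eucl_distC x y : eucl_dist x y = eucl_dist y x.
Proof. by rewrite /eucl_dist -opprB eucl_normN. Qed.

Lemma eucl_dist_triangle y x z :
  eucl_dist x z <= eucl_dist x y + eucl_dist y z.
Proof.
by rewrite /eucl_dist (le_trans _ (ler_eucl_normD _ _))// addrA subrK.
Qed.

Lemma continuous_eucl_dist x : continuous (eucl_dist x).
Proof.
move=> y; rewrite /eucl_dist /eucl_norm.
apply: (@continuous_comp _ _ _ (fun z => \sum_(i < n) (x - z) ord0 i ^+ 2)
  (@Num.sqrt R)); last exact: sqrt_continuous.
rewrite /continuous_at; apply: cvg_big; last move=> i _.
  by move=> ?; exact: add_continuous.
  exact: nbhs_filter.
  
rewrite (_ : (fun z => _) = (fun z => (x ord0 i - z ord0 i) ^+ 2)); last first.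
  by apply/funext => z; rewrite !mxE.
rewrite (_ : ((x - y) ord0 i) = (x ord0 i - y ord0 i)); last by rewrite !mxE.
apply: (@continuous_comp _ _ _ (fun z : 'rV[R]_n => x ord0 i - z ord0 i)
  (fun t : R => t ^+ 2)); last exact: exprn_continuous.
by apply: continuousB; [exact: cst_continuous|exact: coord_continuous].
Qed.

Lemma open_eucl_ball x r : open (eucl_ball x r).
Proof.
rewrite (_ : eucl_ball x r = eucl_dist x @^-1` [set t | t < r])//.
apply: open_comp; last exact: open_lt.
by move=> y _; exact: continuous_eucl_dist.
Qed.

(** Neighbourhoods come from the sup norm, whose balls contain the Euclidean balls of the same
    radius. *)
Lemma nbhs_eucl_ball x (U : set 'rV[R]_n) : nbhs x U ->
  exists2 d : R, 0 < d & eucl_ball x d `<=` U.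
Proof.
move=> /nbhs_ballP[d /= d0 dU]; exists d => // y xy; apply: dU.
split=> // i j; rewrite ord1 /ball/= (le_lt_trans _ xy)//.
by have := coord_le_eucl_norm (x - y) j; rewrite !mxE.
Qed.

Lemma eucl_ball_center x (r : R) : 0 < r -> eucl_ball x r x.
Proof. by move=> r0; rewrite /eucl_ball/= eucl_distxx. Qed.

Lemma eucl_ball_sub x y (r r' : R) : eucl_dist x y + r' <= r ->
  eucl_ball y r' `<=` eucl_ball x r.
Proof.
move=> h z yz; rewrite /eucl_ball/= (le_lt_trans (eucl_dist_triangle y _ _))//.
by rewrite (lt_le_trans _ h)// ltrD2l.
Qed.

Lemma le_eucl_diam (A : set 'rV[R]_n) x y : A x -> A y ->
  ((eucl_dist x y)%:E <= eucl_diam A)%E.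
Proof.
move=> Ax Ay; rewrite /eucl_diam le_max; apply/orP; right.
by apply: ereal_sup_ubound; exists (x, y).
Qed.

End euclidean_distance.

(** * Measurability of distances, balls and compact sets *)

Section euclidean_measurability.
Context {R : realType} {n : nat}.

Lemma measurable_eucl_norm d (T : measurableType d) (f : T -> 'rV[R]_n) :
  measurable_fun setT f -> measurable_fun setT (fun t => eucl_norm (f t)).
Proof.
move=> mf; apply: (@measurableT_comp _ _ _ _ _ _ (@Num.sqrt R)).
  by apply: continuous_measurable_fun; exact: sqrt_continuous.
apply: measurable_sum => i; apply: measurable_funX.
exact: (measurableT_comp (measurable_rV_coord i) mf).
Qed.

Lemma measurable_eucl_dist d (T : measurableType d) (f g : T -> 'rV[R]_n) :
  measurable_fun setT f -> measurable_fun setT g ->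
  measurable_fun setT (fun t => eucl_dist (f t) (g t)).
Proof.
move=> mf mg; apply: measurable_eucl_norm.
apply: measurable_fun_rV_coordP => i.
rewrite (_ : _ \o _ = (rV_coord i \o f) \- (rV_coord i \o g)); last first.
  by apply/funext => t; rewrite /rV_coord/= !mxE.
by apply: measurable_funB;
  exact: (measurableT_comp (measurable_rV_coord i)).
Qed.

Lemma measurable_eucl_lt d (T : measurableType d) (f g : T -> 'rV[R]_n)
    (h : T -> R) :
  measurable_fun setT f -> measurable_fun setT g -> measurable_fun setT h ->
  measurable [set t | eucl_dist (f t) (g t) < h t].
Proof.
move=> mf mg mh; rewrite -[X in measurable X]setTI.
exact: (measurable_fun_ltr (measurable_eucl_dist mf mg) mh measurableT
  (Y := [set true])).
Qed.

Lemma measurable_eucl_ball (x : 'rV[R]_n) r : measurable (eucl_ball x r).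
Proof.
by apply: (@measurable_eucl_lt _ _ (cst x) id (cst r)).
Qed.

(** The sigma-algebra is generated by coordinates, not by open sets. So [E] is written as the
    intersection over k of finite unions of balls of radius 1/(k+1) centred in [E]: a point of all
    these unions is a limit of points of [E], and [E] is closed. *)
Lemma compact_measurable_rV (E : set 'rV[R]_n) : compact E -> measurable E.
Proof.
move=> cE.
have fin (k : nat) : exists D : {fset 'rV[R]_n}, {subset D <= E} /\
    E `<=` \bigcup_(x in [set` D]) eucl_ball x k.+1%:R^-1.
  move: (cE); rewrite compact_cover => /(_ _ E (fun x => eucl_ball x k.+1%:R^-1))[].
  - by move=> x _; exact: open_eucl_ball.
  - by move=> x Ex; exists x => //; apply: eucl_ball_center; rewrite invr_gt0.
  - by move=> D DE ED; exists D.
have [D /all_and2[DE ED]] := choice fin.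
rewrite (_ : E = \bigcap_k \bigcup_(x in [set` D k]) eucl_ball x k.+1%:R^-1).
  apply: bigcap_measurable => // k _; apply: fin_bigcup_measurable => //.
  by move=> x _; exact: measurable_eucl_ball.
apply/seteqP; split; first by move=> x Ex k _; exact: ED.
move=> x Dx; apply: (compact_closed _ cE) => [|U Ux]; first exact: norm_hausdorff.
have [d d0 dU] := nbhs_eucl_ball Ux.
have [k kd] : exists k : nat, k.+1%:R^-1 < d.
  have [k kd] := ltr_add_invr d0; exists k; by rewrite add0r in kd.
have [y /DE yE xy] := Dx k I.
exists y; split; first exact: set_mem yE.
by apply: dU; rewrite /eucl_ball/= eucl_distC (lt_trans xy).
Qed.

End euclidean_measurability.
(** * Ahlfors regular sets and weighted measures *)

Section sigma_finite_structure.
Context d (T : measurableType d) (R : realType).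
Variable mu : {measure set T -> \bar R}.
Hypothesis mu_sigma_finite : sigma_finite setT mu.

Let copy : set T -> \bar R := mu.

HB.instance Definition _ := Measure.on copy.
HB.instance Definition _ :=
  Measure_isSigmaFinite.Build _ _ _ copy mu_sigma_finite.

(** Tonelli takes bundled sigma-finite measures while the theorem takes plain ones; an equality of
    measures allows substitution everywhere. *)
Lemma sigma_finite_measure_ex :
  exists m : {sigma_finite_measure set T -> \bar R}, mu = m.
Proof.
by exists (copy : {sigma_finite_measure set T -> \bar R}); exact: eq_measure.
Qed.

End sigma_finite_structure.

Section weighted_sigma_finite.
Context {R : realType} {n : nat}.

(** Where the density is at most k, mu is at most k times Lebesgue measure. The complement of [B] is
    mu-null and can be added to every piece of the cover. *)
Lemma weighted_measure_sigma_finite (B : set 'rV[R]_n)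
    (mu : {measure set 'rV[R]_n -> \bar R}) :
  measurable B -> weighted_measure B mu -> sigma_finite setT mu.
Proof.
move=> mB [w [w0 [mw _] muE]].
have /sigma_finiteP[F [TF ndF Foo]] := sigma_finiteT (lebesgue_rV (R := R) n).
pose W k := B `&` [set x | w x <= k%:R].
have mW k : measurable (W k).
  have := mw mB _ (measurable_itv `]-oo, (k%:R : R)]).
  by rewrite /W; congr measurable; apply/seteqP; split => x /=; rewrite in_itv.
have mG k : measurable (~` B `|` (W k `&` F k)).
  apply: measurableU; first exact: measurableC.
  by apply: measurableI => //; exact: (Foo k).1.
exists (fun k => ~` B `|` (W k `&` F k)) => [|k].
  apply/esym; rewrite -subTset => x _.
  have [Bx|] := pselect (B x); last by move=> ?; exists 0%N => //; left.
  have [k _ Fkx] : (\bigcup_i F i) x by rewrite -TF.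
  exists (maxn k (Num.truncn (w x)).+1) => //; right; split; last first.
    by have /subsetPset := ndF _ _ (leq_maxl k (Num.truncn (w x)).+1); exact.
  split=> //=; apply: (le_trans (ltW (truncnS_gt _))).
  by rewrite ler_nat leq_maxr.
have mD : measurable (W k `&` F k `&` B).
  by apply: measurableI => //; apply: measurableI => //; exact: (Foo k).1.
split=> //; rewrite muE// setIUl setICl set0U.
apply: (@le_lt_trans _ _
    (\int[lebesgue_rV n]_(x in W k `&` F k `&` B) k%:R%:E)%E).
  apply: ge0_le_integral => //.
  - by move=> x _; rewrite lee_fin.
  - by apply/measurable_EFinP; exact: (measurable_funS mB (@subIsetr _ _ _) mw).
  - by move=> x [[[_ wx] _] _]; rewrite lee_fin.
rewrite integral_cst// lte_mul_pinfty// ?lee_fin//.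
apply: le_lt_trans (Foo k).2; apply: le_measure; rewrite ?inE//; first exact: (Foo k).1.
by move=> x [[]].
Qed.

End weighted_sigma_finite.

Section ahlfors.
Context {R : realType} {n : nat}.
Variables (Q : R) (E : set 'rV[R]_n) (nu : {measure set 'rV[R]_n -> \bar R}).
Hypotheses (Q0 : 0 < Q) (cE : compact E) (E1 : (eucl_diam E <= 1)%E).
Hypothesis aE : ahlfors_regular Q E.
Hypothesis nuE : forall A, measurable A -> nu A = hausdorff Q (A `&` E).

Let diam_ge0 : (0 <= eucl_diam E)%E.
Proof. by rewrite /eucl_diam le_max lexx. Qed.

Let diamE : (fine (eucl_diam E))%:E = eucl_diam E.
Proof.
rewrite fineK// ge0_fin_numE//.
by rewrite (le_lt_trans E1)// ltry.
Qed.

(** Regularity is vacuous here, since no radius satisfies 0 < r <= diam E. Instead [E], repeated, is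
    a cover of itself whose terms are all 0^Q = 0. *)
Lemma diam0_measure0 : eucl_diam E = 0%E -> nu setT = 0%E.
Proof.
move=> d0; apply/eqP; rewrite eq_le measure_ge0 andbT nuE//.
apply: ge_ereal_sup => _ [d /= d_gt0 <-].
apply: ereal_inf_lbound; exists (fun _ => E); last first.
  by rewrite eseries0// => i _ _; rewrite d0 poweR0r// gt_eqF.
by split=> [x [_ Ex]|i]; [exists 0%N|rewrite d0 lee_fin ltW].
Qed.

(** Finitely many balls of radius diam E, the largest radius for which regularity speaks, cover
    [E]. *)
Lemma ahlfors_finite : (nu setT < +oo)%E.
Proof.
have mE := compact_measurable_rV cE.
have [d0|d0] := eqVneq (eucl_diam E) 0%E; first by rewrite diam0_measure0.
pose D := fine (eucl_diam E).
have D0 : 0 < D by rewrite -lte_fin diamE lt0e d0.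
have -> : nu setT = nu E by rewrite !nuE// setIid setTI.
move: (cE); rewrite compact_cover => /(_ _ E (fun x => eucl_ball x D))[].
- by move=> x _; exact: open_eucl_ball.
- by move=> x Ex; exists x => //; exact: eucl_ball_center.
move=> F FE EF; have [C _ CE] := aE.
apply: (@le_lt_trans _ _ (\sum_(x \in [set` F]) nu (eucl_ball x D))%E).
  by apply: content_sub_fsum => // x _; exact: measurable_eucl_ball.
rewrite fsbig_finite//= big_seq; apply: lte_sum_pinfty => x.
rewrite set_fsetK => /FE/set_mem Ex.
rewrite nuE; last exact: measurable_eucl_ball.
have := CE x D Ex D0; rewrite diamE lexx => /(_ isT)/andP[_].
by rewrite setIC => /le_lt_trans; apply; exact: ltry.
Qed.

(** Regularity is extended to all centres and all radii: after the use of Tonelli the centres are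
    points of the domain of mu, in general outside [E]. *)
Lemma ahlfors_upper : exists2 C : R, 0 < C &
  forall x r, 0 < r -> (nu (eucl_ball x r) <= (C * r `^ Q)%:E)%E.
Proof.
have nuT : nu setT = (fine (nu setT))%:E.
  by rewrite fineK// ge0_fin_numE// ahlfors_finite.
have le_nuT x r : (nu (eucl_ball x r) <= (fine (nu setT))%:E)%E.
  by rewrite -nuT le_measure// ?inE//; exact: measurable_eucl_ball.
have [d0|d0] := eqVneq (eucl_diam E) 0%E.
  exists 1 => // x r r0; rewrite (le_trans (le_nuT _ _))//.
  by rewrite diam0_measure0// lee_fin mul1r powR_ge0.
pose D := fine (eucl_diam E).
have D0 : 0 < D by rewrite -lte_fin diamE lt0e d0.
have [C C1 CE] := aE.
(* The first summand serves 2r <= D: a ball meeting [E] at y lies in B(y, 2r). The second serves 2r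
   > D, where (2r/D)^Q >= 1 and the total mass is a sufficient bound. *)
exists (C * 2 `^ Q + fine (nu setT) * (2 / D) `^ Q) => [|x r r0].
  apply: ltr_wpDr; first by rewrite mulr_ge0 ?powR_ge0// fine_ge0.
  by rewrite mulr_gt0 ?powR_gt0// (lt_le_trans _ C1).
have mB := @measurable_eucl_ball R n x r.
have [[y [Ey xy]]|NE] := pselect (E `&` eucl_ball x r !=set0); last first.
  rewrite nuE// setIC; move/set0P/negP/negPn/eqP : NE => ->.
  have := nuE (@measurable0 _ _); rewrite set0I measure0 => <-.
  rewrite lee_fin mulr_ge0 ?powR_ge0// addr_ge0// mulr_ge0 ?powR_ge0//.
    exact: le_trans C1.
rewrite mulrDl -!mulrA -!powRM ?(ltW r0)// ?divr_ge0// ?(ltW D0)//.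
have [rD|rD] := leP (2 * r) D.
  apply: (@le_trans _ _ (nu (eucl_ball y (2 * r)))).
    rewrite le_measure// ?inE//; first exact: measurable_eucl_ball.
    apply: eucl_ball_sub; rewrite eucl_distC; move: xy; rewrite /eucl_ball/=.
    by lra.
  rewrite nuE; last exact: measurable_eucl_ball.
  have := CE y (2 * r) Ey; rewrite -diamE lee_fin mulr_gt0// rD.
  move=> /(_ isT isT)/andP[_]; rewrite setIC => /le_trans; apply.
  by rewrite lee_fin lerDl mulr_ge0 ?powR_ge0// fine_ge0.
apply: (le_trans (le_nuT _ _)); rewrite lee_fin.
rewrite -[leLHS]add0r lerD ?mulr_ge0 ?powR_ge0//; first exact: le_trans C1.
rewrite ler_peMr ?fine_ge0// -[leLHS](powRr0 (2 / D * r)) ler_powR//.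
  by rewrite mulrAC ler_pdivlMr// mul1r ltW.
exact: ltW.
Qed.

Lemma ahlfors_lower : exists2 c : R, 0 < c &
  forall x y, E x -> E y -> x <> y ->
    ((c * eucl_dist x y `^ Q)%:E <= nu (eucl_ball x (eucl_dist x y)))%E.
Proof.
have [C C1 CE] := aE; exists C^-1; first by rewrite invr_gt0 (lt_le_trans _ C1).
move=> x y Ex Ey xy.
have xy0 : 0 < eucl_dist x y.
  by rewrite lt0r eucl_dist_ge0 andbT; apply/eqP => /eucl_dist_eq0.
have /andP[+ _] := CE _ _ Ex xy0 (le_eucl_diam Ex Ey).
by rewrite setIC nuE//; exact: measurable_eucl_ball.
Qed.

End ahlfors.
(** * Integrals, averages and geometric series *)

Section integral_lemmas.
Context d (T : measurableType d) (R : realType).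
Variable mu : {measure set T -> \bar R}.
Local Open Scope ereal_scope.

(* Unlike [ge0_le_integral], this needs no measurability, since the integral of
   a nonnegative function is a supremum over simple functions below it. *)
Lemma le_integral_subset (A D : set T) (f g : T -> \bar R) :
  A `<=` D -> (forall x, A x -> 0 <= f x) -> (forall x, D x -> 0 <= g x) ->
  (forall x, A x -> f x <= g x) ->
  \int[mu]_(x in A) f x <= \int[mu]_(x in D) g x.
Proof.
move=> AD f0 g0 fg; rewrite (integral_mkcond A) (integral_mkcond D).
have fA0 x : 0 <= (f \_ A) x by exact: erestrict_ge0.
have gD0 x : 0 <= (g \_ D) x by exact: erestrict_ge0.
rewrite !ge0_integralTE//; apply: ereal_sup_le => _ [h hf <-].
exists h => // x; apply: (le_trans (hf x)); rewrite /patch.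
case: ifPn => [/set_mem Ax|_]; first by rewrite mem_set ?fg//; exact: AD.
by case: ifPn => // /set_mem; exact: g0.
Qed.

(** Move c inside the average, then enlarge the domain to [A] but keep the factor 1/mu(A'). With c
    the average over [A], the right-hand side is what a Poincaré inequality on [A] controls. *)
Lemma average_dist_le (A A' : set T) (u : T -> R) (c : R) :
  measurable A -> measurable A' -> A' `<=` A ->
  mu A < +oo -> 0 < mu A' -> mu.-integrable A (EFin \o u) ->
  `|(fine (mu A'))^-1 * (\int[mu]_(x in A') u x)%R - c|%:E <=
  (fine (mu A'))^-1%:E * \int[mu]_(x in A) `|u x - c|%:E.
Proof.
move=> mA mA' A'A Aoo A'0 iu.
have A'oo : mu A' < +oo by apply: le_lt_trans Aoo; rewrite le_measure// inE.
have m0 : (0 < fine (mu A'))%R by rewrite fine_gt0// A'0.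
have iu' : mu.-integrable A' (EFin \o u) by exact: integrableS iu.
have ic : mu.-integrable A' (EFin \o cst c).
  apply/integrableP; split; first by apply/measurable_EFinP; exact: measurable_cst.
  by rewrite /= integral_cst// lte_mul_pinfty// lee_fin.
have -> : ((fine (mu A'))^-1 * (\int[mu]_(x in A') u x)%R - c =
    (fine (mu A'))^-1 * (\int[mu]_(x in A') (u x - c))%R)%R.
  rewrite RintegralB// Rintegral_cst// mulrBr.
  by congr (_ - _)%R; rewrite mulrCA mulVf ?mulr1// gt_eqF.
rewrite normrM gtr0_norm ?invr_gt0// EFinM lee_pmul2l ?lte_fin ?invr_gt0//.
have iuc : mu.-integrable A' (EFin \o (fun x => u x - c)%R).
  have := integrableB mA' iu' ic; congr integrable.
rewrite EFin_normr_Rintegral//.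
apply: (le_trans (le_abse_integral _ _ _)) => //.
  exact: (measurable_int mu).
by apply: le_integral_subset => // x _; rewrite lee_fin.
Qed.

End integral_lemmas.

Section real_lemmas.
Context {R : realType}.

Lemma powRD_le (p a b : R) : 0 <= p -> 0 <= a -> 0 <= b ->
  (a + b) `^ p <= 2 `^ p * (a `^ p + b `^ p).
Proof.
move=> p0; wlog ab : a b / a <= b => [h a0 b0|a0 b0].
  have [ab|/ltW ba] := leP a b; first exact: h.
  by rewrite addrC (addrC (a `^ p)); exact: h.
apply: (@le_trans _ _ ((2 * b) `^ p)).
  by apply: ge0_ler_powR; rewrite ?nnegrE ?addr_ge0 ?mulr_ge0//; lra.
by rewrite powRM// ler_wpM2l ?powR_ge0// lerDr powR_ge0.
Qed.

Lemma ler_dist4 (a b c d e : R) :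
  `|a - e| <= `|a - b| + `|c - b| + `|c - d| + `|e - d|.
Proof.
have -> : a - e = (a - b) - (c - b) + (c - d) - (e - d) by ring.
rewrite (le_trans (ler_normB _ _))// lerD2r (le_trans (ler_normD _ _))//.
by rewrite lerD2r ler_normB.
Qed.

(** For t > lam write t = t^(1-p) t^p and use 1 - p <= 0. Integrated, with [lam] chosen afterwards,
    this does the work of Hölder's inequality. *)
Lemma ler_powR_interp (p lam t : R) : 1 <= p -> 0 < lam -> 0 <= t ->
  t <= lam + lam `^ (1 - p) * t `^ p.
Proof.
move=> p1 lam0 t0.
have [h|h] := leP t lam; first by rewrite ler_wpDr// mulr_ge0// powR_ge0.
have {}t0 : 0 < t by exact: lt_trans h.
have tE : t = t `^ (1 - p) * t `^ p.
  by rewrite -powRD ?(gt_eqF t0) ?implybT// subrK powRr1// ltW.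
rewrite {1}tE ler_wpDl ?(ltW lam0)// ler_wpM2r ?powR_ge0//.
rewrite -opprB !powRN lef_pV2 ?posrE ?powR_gt0//.
by apply: ge0_ler_powR; rewrite ?nnegrE ?subr_ge0 ?(ltW t0) ?(ltW lam0) ?(ltW h).
Qed.

Lemma powR_exprn (x a : R) k : 0 <= x -> (x ^+ k) `^ a = (x `^ a) ^+ k.
Proof.
by move=> x0; rewrite -(powR_mulrn k x0) -(powR_mulrn k (powR_ge0 x a)) powRAC.
Qed.

Lemma eseries_geometric (a z : R) : 0 <= z < 1 ->
  (\sum_(k <oo) (a * z ^+ k)%:E = (a / (1 - z))%:E)%E.
Proof.
move=> /andP[z0 z1].
have cz : series (geometric a z) @ \oo --> a / (1 - z).
  by apply: cvg_geometric_series; rewrite ger0_norm.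
rewrite -(cvg_lim _ cz)// -EFin_lim; last by apply/cvg_ex; eexists; exact: cz.
by congr (lim (_ @ \oo)); apply/funext => k /=; rewrite sumEFin.
Qed.

Lemma cvg_geometric_increments (a : R^nat) (A t : R) : 0 <= t < 1 ->
  (forall k, `|a k.+1 - a k| <= A * t ^+ k) ->
  exists2 l, a @ \oo --> l & `|l - a 0| <= A / (1 - t).
Proof.
move=> /andP[t0 t1] aA.
have cz : series (geometric A t) @ \oo --> A / (1 - t).
  by apply: cvg_geometric_series; rewrite ger0_norm.
have cz' : cvgn (series (geometric A t)) by apply/cvg_ex; eexists; exact: cz.
have cn : cvgn [normed series (telescope a)].
  by apply: (series_le_cvg _ _ aA cz') => // k; rewrite (le_trans _ (aA k)).
have cs := normed_cvg cn.
exists (limn (series (telescope a)) + a 0).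
  have aE : series (telescope a) \+ cst (a 0) = a.
    by apply/funext => k; rewrite telescopeK/= subrK.
  by rewrite -[X in X @ _ --> _]aE; exact: (cvgD cs (@cvg_cst _ _ _ _ _)).
rewrite addrK (le_trans (lim_series_norm cn))// -(cvg_lim _ cz)//.
exact: lim_series_le.
Qed.

End real_lemmas.

Section integral_interpolation.
Context d (T : measurableType d) (R : realType).
Variable mu : {measure set T -> \bar R}.
Local Open Scope ereal_scope.

Lemma integral_norm_interp (A : set T) (f : T -> R) (p lam : R) :
  measurable A -> measurable_fun A f -> (1 <= p)%R -> (0 < lam)%R ->
  \int[mu]_(z in A) `|f z|%:E <=
  lam%:E * mu A + (lam `^ (1 - p))%:E * \int[mu]_(z in A) (`|f z| `^ p)%:E.
Proof.
move=> mA mf p1 lam0.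
have mf1 : measurable_fun A (fun z => `|f z|%:E).
  by apply/measurable_EFinP; exact: measurableT_comp.
have mfp : measurable_fun A (fun z => (`|f z| `^ p)%:E).
  apply/measurable_EFinP; apply: (measurableT_comp (measurable_powR _)).
  exact: measurableT_comp.
have l0 : 0 <= (lam `^ (1 - p))%:E by rewrite lee_fin powR_ge0.
have fp0 z : 0 <= (`|f z| `^ p)%:E by rewrite lee_fin powR_ge0.
have mlfp : measurable_fun A (fun z => (lam `^ (1 - p))%:E * (`|f z| `^ p)%:E).
  exact: measurable_funeM.
rewrite -(integral_cst mu mA lam%:E) -ge0_integralZl//.
rewrite -ge0_integralD//; last first.
- by move=> z _; rewrite mule_ge0.
- by move=> z _; rewrite lee_fin ltW.
apply: ge0_le_integral => //.
- by apply: emeasurable_funD => //; exact: measurable_cst.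
- by move=> z _; rewrite -EFinM -EFinD lee_fin ler_powR_interp.
Qed.

End integral_interpolation.

(** * Tonelli for integrals over moving balls *)

Section ball_fubini.
Context {R : realType} {n : nat}.
Variables (m1 m2 : {sigma_finite_measure set 'rV[R]_n -> \bar R}) (r : R).
Variable phi : 'rV[R]_n -> \bar R.
Hypothesis mphi : measurable_fun setT phi.
Hypothesis phi0 : forall x, (0 <= phi x)%E.
Local Open Scope ereal_scope.

Let W := [set w : 'rV[R]_n * 'rV[R]_n | (eucl_dist w.1 w.2 < r)%R].

Let mW : measurable W.
Proof. by apply: (@measurable_eucl_lt _ _ _ _ fst snd (cst r)). Qed.

(** The integral over a ball around x becomes the integral of a section of one measurable function
    on the product. As [W] is symmetric, the sections in the other variable are balls too. *)
Let K (w : 'rV[R]_n * 'rV[R]_n) : \bar R := phi w.2 * (\1_W w)%:E.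

Let mK : measurable_fun setT K.
Proof.
apply: emeasurable_funM; first exact: measurableT_comp.
by apply/measurable_EFinP; exact: measurable_indic.
Qed.

Let K0 w : 0 <= K w.
Proof. by rewrite mule_ge0// lee_fin. Qed.

Let ballE x : \int[m2]_(z in eucl_ball x r) phi z = \int[m2]_z K (x, z).
Proof.
rewrite integral_mkcond; apply: eq_integral => z _; rewrite /K patchE indicE/=.
have [h|h] := pselect (eucl_dist x z < r)%R.
  by rewrite !mem_set// mule1.
by rewrite !memNset// mule0.
Qed.

Lemma measurable_ball_integral :
  measurable_fun setT (fun x => \int[m2]_(z in eucl_ball x r) phi z).
Proof.
have -> : (fun x => \int[m2]_(z in eucl_ball x r) phi z) = fubini_F m2 K.
  by apply/funext => x; exact: ballE.
exact: measurable_fun_fubini_tonelli_F.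
Qed.

Lemma ball_integral_swap :
  \int[m1]_x \int[m2]_(z in eucl_ball x r) phi z =
  \int[m2]_z (phi z * m1 (eucl_ball z r)).
Proof.
transitivity (\int[m1]_x \int[m2]_z K (x, z)).
  by apply: eq_integral => x _; exact: ballE.
rewrite fubini_tonelli//; apply: eq_integral => z _.
rewrite /K/= ge0_integralZl//; last first.
  apply/measurable_EFinP.
  exact: (measurableT_comp (measurable_indic mW)).
congr (_ * _); transitivity (\int[m1]_x (\1_(eucl_ball z r) x)%:E); last first.
  by rewrite integral_indic ?setIT//; exact: measurable_eucl_ball.
apply: eq_integral => x _; rewrite !indicE; congr ((nat_of_bool _)%:R%:E).
by apply/idP/idP => /set_mem h; apply/mem_set; move: h;
  rewrite /eucl_ball /W/= eucl_distC.
Qed.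

End ball_fubini.
(** * Dyadic averages and the potential of the gradient *)

Section dyadic_potential.
Context {R : realType} {n : nat}.
Variables (mu : {sigma_finite_measure set 'rV[R]_n -> \bar R}).
Variables (B : set 'rV[R]_n) (p theta s : R).
Hypothesis mB : measurable B.

(* The factor 3 / 2 leaves room for the ball of radius [rad j.+2] around [y] in
   the ball of radius [rad j] around [x] as soon as [x] and [y] are at distance
   at most 2^-j, while all radii stay below 2. *)
Definition dyadic_radius (k : nat) : R := 3 / 2 * 2^-1 ^+ k.
Local Notation rad := dyadic_radius.

Definition dyadic_ball k (x : 'rV[R]_n) := eucl_ball x (rad k) `&` B.

Definition dyadic_average u k x := average mu (dyadic_ball k x) u.

(* The limit superior makes [trace_op u] measurable; it is a limit wherever the
   dyadic averages converge. *)
Definition trace_op (u : 'rV[R]_n -> R) (x : 'rV[R]_n) : R :=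
  fine (limn_esup (fun k => (dyadic_average u k x)%:E)).

Definition energy (h : 'rV[R]_n -> R) k x : \bar R :=
  \int[mu]_(z in dyadic_ball k x) (h z `^ p)%:E.

(* The weights are such that [potential (eucl_norm \o g) j] controls
   [(rad k `^ - theta * |u_k - u_k.+1|) `^ p] for all [k >= j], where [u_k] is the
   k-th dyadic average of a function with gradient [g]. *)
Definition potential h j x : \bar R :=
  (\sum_(k <oo) (rad (j + k) `^ ((1 - theta) * p - s))%:E * energy h (j + k) x)%E.

Lemma dyadic_radius_gt0 k : 0 < rad k.
Proof. by rewrite mulr_gt0// exprn_gt0// invr_gt0. Qed.

Lemma dyadic_radius_lt2 k : rad k < 2.
Proof.
have : 2^-1 ^+ k <= 1 :> R by rewrite exprn_ile1// invf_le1// ler1n.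
by rewrite /rad; lra.
Qed.

Lemma dyadic_radiusS k : rad k.+1 = rad k / 2.
Proof. by rewrite /rad exprSr mulrA. Qed.

Lemma dyadic_radiusD j k : rad (j + k) = rad j * 2^-1 ^+ k.
Proof. by rewrite /rad exprD mulrA. Qed.

Lemma dyadic_radius_le j k : (j <= k)%N -> rad k <= rad j.
Proof.
move=> jk; rewrite -(subnKC jk) dyadic_radiusD ler_piMr ?(ltW (dyadic_radius_gt0 j))//.
by rewrite exprn_ile1// invf_le1// ler1n.
Qed.

Lemma dyadic_radius_le4 k l : (l <= k.+2)%N -> rad k <= 4 * rad l.
Proof. by move=> /dyadic_radius_le; rewrite !dyadic_radiusS; lra. Qed.

(** In units of 2^-j the room is 3/2 - 3/8 = 9/8 >= 1. One halving would leave only 3/4, hence the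
    jump by two levels. *)
Lemma dyadic_radius_slack (d : R) j : d <= 2^-1 ^+ j -> d + rad j.+2 <= rad j.
Proof.
have : 0 <= 2^-1 ^+ j :> R by rewrite exprn_ge0.
by rewrite !dyadic_radiusS /rad; move: (2^-1 ^+ j) => t; lra.
Qed.

Lemma powR_dyadic_radius (a : R) k : rad k `^ a = (3 / 2) `^ a * (2^-1 `^ a) ^+ k.
Proof.
rewrite /rad powRM//; congr (_ * _).
exact: powR_exprn.
Qed.

Lemma powR_dyadic_radiusD (a : R) j k :
  rad (j + k) `^ a = rad j `^ a * (2^-1 `^ a) ^+ k.
Proof. by rewrite !powR_dyadic_radius exprD mulrA. Qed.

Lemma powR_half_lt1 (a : R) : 0 < a -> 0 <= (2^-1 : R) `^ a < 1.
Proof.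
move=> a0; rewrite powR_ge0/=.
have : (2^-1 : R) `^ a < 1 `^ a.
  by apply: gt0_ltr_powR => //; rewrite ?nnegrE ?invr_ge0// invf_lt1 ?ltr1n.
by rewrite powR1.
Qed.

Lemma measurable_dyadic_ball k x : measurable (dyadic_ball k x).
Proof. by apply: measurableI => //; exact: measurable_eucl_ball. Qed.

Lemma energy_ge0 h k x : (0 <= energy h k x)%E.
Proof. by apply: integral_ge0 => z _; rewrite lee_fin powR_ge0. Qed.

Lemma potential_term_ge0 h k x :
  (0 <= (rad k `^ ((1 - theta) * p - s))%:E * energy h k x)%E.
Proof. by rewrite mule_ge0 ?energy_ge0// lee_fin powR_ge0. Qed.

Lemma potential_ge0 h j x : (0 <= potential h j x)%E.
Proof. by apply: nneseries_ge0 => k _ _; exact: potential_term_ge0. Qed.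

Lemma potential_ge h j k x : (j <= k)%N ->
  ((rad k `^ ((1 - theta) * p - s))%:E * energy h k x <= potential h j x)%E.
Proof.
move=> jk.
have h0 i : (0 <= i)%N -> true -> (0 <= (rad (j + i) `^ ((1 - theta) * p - s))%:E *
    energy h (j + i) x)%E by move=> _ _; exact: potential_term_ge0.
apply: le_trans (nneseries_lim_ge (k - j).+1 h0).
rewrite big_nat_recr//= subnKC// leeDr// sume_ge0// => i _.
exact: potential_term_ge0.
Qed.

Section measurability.
Variable h : 'rV[R]_n -> R.
Hypothesis mh : measurable_fun setT (h \_ B).
Hypothesis p0 : 0 < p.

(** Extension by zero moves [B] from the domain into the integrand, so that the Tonelli lemmas on
    full balls apply; 0^p = 0 because p > 0. *)
Let phi x := (((h \_ B) x) `^ p)%:E.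

Let mphi : measurable_fun setT phi.
Proof.
by apply/measurable_EFinP; exact: (measurableT_comp (measurable_powR _) mh).
Qed.

Let phi0 x : (0 <= phi x)%E.
Proof. by rewrite lee_fin powR_ge0. Qed.

Let phiE A : (\int[mu]_(z in A `&` B) (h z `^ p)%:E = \int[mu]_(z in A) phi z)%E.
Proof.
rewrite integral_mkcondr; apply: eq_integral => z _.
by rewrite /phi !patchE; case: ifPn => // _; rewrite powR0// gt_eqF.
Qed.

Lemma measurable_energy k : measurable_fun setT (energy h k).
Proof.
have -> : energy h k = fun x => (\int[mu]_(z in eucl_ball x (rad k)) phi z)%E.
  by apply/funext => x; exact: phiE.
exact: measurable_ball_integral.
Qed.

Lemma measurable_potential j : measurable_fun setT (potential h j).
Proof.
apply: ge0_emeasurable_sum => [k x _ _|k _]; first exact: potential_term_ge0.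
by apply: emeasurable_funM => //; exact: measurable_energy.
Qed.

Variables (nu : {sigma_finite_measure set 'rV[R]_n -> \bar R}) (Q C : R).
Hypothesis nu_upper :
  forall x r, 0 < r -> (nu (eucl_ball x r) <= (C * r `^ Q)%:E)%E.
Hypothesis C0 : 0 <= C.

Let N := (\int[mu]_(z in B) (h z `^ p)%:E)%E.

Lemma integral_energy_le k :
  (\int[nu]_x energy h k x <= (C * rad k `^ Q)%:E * N)%E.
Proof.
under eq_integral do rewrite /energy/dyadic_ball phiE.
rewrite (ball_integral_swap nu mu (rad k) mphi phi0).
have -> : N = (\int[mu]_z phi z)%E by rewrite -phiE setTI.
rewrite -ge0_integralZl//; last first.
  by rewrite lee_fin mulr_ge0// powR_ge0.
apply: le_integral_subset => // x _; first exact: mule_ge0.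
  by rewrite mule_ge0// lee_fin mulr_ge0// powR_ge0.
by rewrite muleC lee_wpmul2r// nu_upper// dyadic_radius_gt0.
Qed.

Let delta := (1 - theta) * p - s + Q.

Lemma integral_potential_le j : 0 < delta -> (N < +oo)%E ->
  (\int[nu]_x potential h j x <=
   (C * (3 / 2) `^ delta / (1 - 2^-1 `^ delta) * (2^-1 `^ delta) ^+ j)%:E * N)%E.
Proof.
move=> delta0 Noo.
have N0 : (0 <= N)%E by apply: integral_ge0 => z _; rewrite lee_fin powR_ge0.
have NE : N = (fine N)%:E by rewrite fineK// ge0_fin_numE.
rewrite integral_nneseries//; last 2 first.
- by move=> k; apply: emeasurable_funM => //; exact: measurable_energy.
- by move=> k x _; exact: potential_term_ge0.
apply: (@le_trans _ _ (\sum_(k <oo)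
    (C * rad j `^ delta * fine N * (2^-1 `^ delta) ^+ k)%:E)%E).
  apply: lee_nneseries => k _.
    by move=> _; apply: integral_ge0 => x _; exact: potential_term_ge0.
  rewrite ge0_integralZl//; last 3 first.
  - exact: measurable_energy.
  - by move=> x _; exact: energy_ge0.
  - by rewrite lee_fin powR_ge0.
  have r0 := dyadic_radius_gt0 (j + k).
  apply: (@le_trans _ _ ((rad (j + k) `^ ((1 - theta) * p - s))%:E *
      ((C * rad (j + k) `^ Q)%:E * N))%E).
    by rewrite lee_wpmul2l ?lee_fin ?powR_ge0//; exact: integral_energy_le.
  rewrite NE -!EFinM lee_fin le_eqVlt; apply/orP; left; apply/eqP.
  have rE : rad (j + k) `^ ((1 - theta) * p - s) * rad (j + k) `^ Q =
      rad j `^ delta * (2^-1 `^ delta) ^+ k.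
    by rewrite -powRD -?powR_dyadic_radiusD// (gt_eqF r0) implybT.
  transitivity (C * (rad j `^ delta * (2^-1 `^ delta) ^+ k) * fine N).
    by rewrite -rE; ring.
  by ring.
rewrite eseries_geometric ?powR_half_lt1// [in leRHS]NE -EFinM lee_fin.
by rewrite powR_dyadic_radius le_eqVlt; apply/orP; left; apply/eqP; ring.
Qed.

End measurability.

End dyadic_potential.
(** * Pointwise estimates of the trace *)

Section trace_pointwise.
Context {R : realType} {n : nat}.
Variables (mu : {sigma_finite_measure set 'rV[R]_n -> \bar R}).
Variables (B E : set 'rV[R]_n) (p theta s Cm Cp : R).
Hypothesis mB : measurable B.
Hypotheses (p1 : 1 < p) (theta01 : 0 < theta < 1) (s0 : 0 < s).
Hypotheses (Cm1 : 1 <= Cm) (Cp0 : 0 <= Cp).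
Hypothesis codim : forall x r, E x -> 0 < r < 2 ->
  ((Cm^-1 * r `^ s)%:E <= mu (eucl_ball x r `&` B) <= (Cm * r `^ s)%:E)%E.
Hypothesis poincare : forall f g, sobolev mu B p f g ->
  forall x r, E x -> 0 < r < 2 ->
  let A := eucl_ball x r `&` B in
  ((mu A)^-1 * \int[mu]_(y in A) `|f y - average mu A f|%:E <=
   (Cp * r)%:E * ((mu A)^-1 * \int[mu]_(y in A) (eucl_norm (g y) `^ p)%:E) `^ p^-1)%E.

Local Notation rad := (@dyadic_radius R).
Local Notation D := (dyadic_ball B).
Local Notation S := (potential mu B p theta s).
Local Notation avg := (dyadic_average mu B).
Local Notation T := (trace_op mu B).

Let Cm0 : 0 < Cm. Proof. exact: lt_le_trans Cm1. Qed.
Let p0 : 0 < p. Proof. exact: lt_trans p1. Qed.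

Lemma Lp_measurable (m : {measure set 'rV[R]_n -> \bar R}) A f : Lp m A p f ->
  measurable_fun setT (f \_ A).
Proof. by rewrite /Lp/= inE => /andP[/[!inE]]. Qed.

(** On a set of finite measure 1 + |f|^p is an integrable majorant of |f|. *)
Lemma Lp_integrable (A : set 'rV[R]_n) f : measurable A -> A `<=` B ->
  (mu A < +oo)%E -> Lp mu B p f -> mu.-integrable A (EFin \o f).
Proof.
move=> mA AB Aoo fp.
have mf : measurable_fun A f.
  apply: (measurable_funS mB AB); apply/(measurable_restrictT _ mB).
  exact: Lp_measurable fp.
have i1 : mu.-integrable A (EFin \o cst (1 : R)).
  apply/integrableP; split; first by apply/measurable_EFinP; exact: measurable_cst.
  by rewrite /= integral_cst// lte_mul_pinfty// lee_fin.
have ip : mu.-integrable A (fun x => (`|(f \_ B) x| `^ p)%:E).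
  by apply: (integrableS measurableT) (Lfun_integrable (ltW p1) fp).
apply: le_integrable (integrableD mA i1 ip) => //.
  exact/measurable_EFinP.
move=> x Ax /=; rewrite patchE mem_set; last exact: AB.
rewrite lee_fin [leRHS]ger0_norm ?addr_ge0 ?powR_ge0//.
have [h|h] := leP `|f x| 1; first by rewrite ler_wpDr// powR_ge0.
by rewrite ler_wpDl//; apply: le1r_powR; exact: ltW.
Qed.

Lemma dyadic_measure k x : E x ->
  [/\ mu (D k x) = (fine (mu (D k x)))%:E,
      Cm^-1 * rad k `^ s <= fine (mu (D k x)) &
      fine (mu (D k x)) <= Cm * rad k `^ s].
Proof.
move=> Ex; have := codim Ex (r := rad k).
rewrite dyadic_radius_gt0 dyadic_radius_lt2 => /(_ isT)/andP[h1 h2].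
have mE : mu (D k x) = (fine (mu (D k x)))%:E.
  by rewrite fineK// ge0_fin_numE// (le_lt_trans h2) ?ltry.
by split=> //; rewrite -lee_fin -mE.
Qed.

Lemma dyadic_measure_gt0 k x : E x -> 0 < fine (mu (D k x)).
Proof.
move=> /(dyadic_measure k)[_ h _]; apply: lt_le_trans h.
by rewrite mulr_gt0 ?invr_gt0 ?powR_gt0 ?dyadic_radius_gt0.
Qed.

Lemma dyadic_average_dist_le f k l x y c : E x -> E y -> D l y `<=` D k x ->
  Lp mu B p f ->
  (`|avg f l y - c|%:E <= (fine (mu (D l y)))^-1%:E *
     \int[mu]_(z in D k x) `|f z - c|%:E)%E.
Proof.
move=> Ex Ey Dyx fp; have [mxE _ _] := dyadic_measure k Ex.
have [myE _ _] := dyadic_measure l Ey.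
have mDx : measurable (D k x) by exact: measurable_dyadic_ball.
have mDy : measurable (D l y) by exact: measurable_dyadic_ball.
have mxoo : (mu (D k x) < +oo)%E by rewrite mxE ltry.
have my0 : (0 < mu (D l y))%E by rewrite myE lte_fin dyadic_measure_gt0.
apply: average_dist_le => //.
by apply: Lp_integrable => //; exact: subIsetr.
Qed.

Let K1 := 4 `^ s * Cm ^+ 2 * Cp * Cm `^ p^-1.

Let K1_ge0 : 0 <= K1.
Proof.
by rewrite mulr_ge0 ?powR_ge0// mulr_ge0// mulr_ge0 ?powR_ge0 ?sqr_ge0.
Qed.

(** Arithmetic of one increment: m and m' are the measures of the large and the small ball, I is the
    energy, sigma the potential. The ratio m/m' costs 4^s Cm^2. Since I/m <= Cm sigma
    r^(-(1-theta)p), its p-th root turns the factor r of the Poincaré inequality into r^theta. *)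
Let step_bound r r' m m' I sigma : 0 < r -> r <= 4 * r' ->
  0 < m -> 0 < m' -> 0 <= I -> 0 <= sigma ->
  Cm^-1 * r `^ s <= m -> m <= Cm * r `^ s -> Cm^-1 * r' `^ s <= m' ->
  r `^ ((1 - theta) * p - s) * I <= sigma ->
  m'^-1 * (m * (Cp * r * (m^-1 * I) `^ p^-1)) <= K1 * r `^ theta * sigma `^ p^-1.
Proof.
move=> r0 rr' m0 m'0 I0 sg0 h1 h2 h3 h4.
have r'0 : 0 < r' by lra.
have mm' : m'^-1 * m <= 4 `^ s * Cm ^+ 2.
  rewrite mulrC ler_pdivrMr//; apply: (le_trans h2).
  have : r `^ s <= 4 `^ s * r' `^ s.
    rewrite -powRM//; last exact: ltW.
    by apply: ge0_ler_powR => //; rewrite ?nnegrE ?ltW// mulr_gt0.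
  move: h3; rewrite ler_pdivrMl// => h3 h5.
  have -> : 4 `^ s * Cm ^+ 2 * m' = Cm * (4 `^ s * (Cm * m')) by ring.
  by rewrite ler_pM2l// (le_trans h5)// ler_wpM2l ?powR_ge0.
have mI : m^-1 * I <= Cm * sigma * r `^ (- ((1 - theta) * p)).
  apply: (@le_trans _ _ (Cm * r `^ (- s) * I)).
    apply: ler_wpM2r => //; rewrite powRN -[Cm]invrK -invfM lef_pV2 ?posrE//.
    by rewrite mulr_gt0 ?invr_gt0// powR_gt0.
  rewrite -!mulrA ler_pM2l//.
  have -> : - s = ((1 - theta) * p - s) + - ((1 - theta) * p) by ring.
  rewrite powRD; last by rewrite (gt_eqF r0) implybT.
  by rewrite mulrAC ler_wpM2r ?powR_ge0.
have rt : r * r `^ (theta - 1) = r `^ theta.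
  rewrite -{1}(powRr1 (ltW r0)) -powRD ?(gt_eqF r0) ?implybT//.
  by congr (_ `^ _); ring.
have : (m^-1 * I) `^ p^-1 <= Cm `^ p^-1 * sigma `^ p^-1 * r `^ (theta - 1).
  apply: (@le_trans _ _ ((Cm * sigma * r `^ (- ((1 - theta) * p))) `^ p^-1)).
    apply: ge0_ler_powR => //; rewrite ?nnegrE ?invr_ge0 ?(ltW p0)//.
      by rewrite mulr_ge0// invr_ge0 ltW.
    by rewrite !mulr_ge0 ?powR_ge0// ltW.
  rewrite !powRM ?powR_ge0 ?mulr_ge0 ?(ltW Cm0)// -powRrM.
  rewrite (_ : _ * p^-1 = theta - 1)//.
  by rewrite mulNr mulfK ?gt_eqF// opprB.
move=> h5; rewrite mulrA /K1 -rt.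
apply: (@le_trans _ _ (4 `^ s * Cm ^+ 2 *
    (Cp * r * (Cm `^ p^-1 * sigma `^ p^-1 * r `^ (theta - 1))))).
  apply: ler_pM => //; first by rewrite mulr_ge0 ?invr_ge0 ?ltW.
    by rewrite !mulr_ge0 ?powR_ge0// ltW.
  by rewrite ler_wpM2l// mulr_ge0// ltW.
by rewrite le_eqVlt; apply/orP; left; apply/eqP; ring.
Qed.

(** Two points and two levels are allowed so that one statement covers both consecutive levels at
    one point and the passage from level j at x to level j+2 at y. *)
Let dyadic_step f g x y j k l : sobolev mu B p f g ->
  E x -> E y -> (j <= k)%N -> (l <= k.+2)%N -> D l y `<=` D k x ->
  (S (eucl_norm \o g) j x < +oo)%E ->
  `|avg f l y - avg f k x| <=
    K1 * rad k `^ theta * fine (S (eucl_norm \o g) j x) `^ p^-1.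
Proof.
move=> fg Ex Ey jk lk Dyx Soo.
have [fp _ _] := fg.
have r0 := @dyadic_radius_gt0 R k.
have [mE m1 m2] := dyadic_measure k Ex; have m0 := dyadic_measure_gt0 k Ex.
have [m'E m'1 _] := dyadic_measure l Ey; have m'0 := dyadic_measure_gt0 l Ey.
have sg0 := @potential_ge0 R n mu B p theta s (eucl_norm \o g) j x.
have sE : S (eucl_norm \o g) j x = (fine (S (eucl_norm \o g) j x))%:E.
  by rewrite fineK// ge0_fin_numE.
have := @potential_ge R n mu B p theta s (eucl_norm \o g) j k x jk.
set w := rad k `^ _.
have w0 : 0 < w by rewrite powR_gt0.
have I0 := @energy_ge0 R n mu B p (eucl_norm \o g) k x.
(* An infinite energy, times its positive weight, would make the potential infinite. *)
have Ioo : (energy mu B p (eucl_norm \o g) k x < +oo)%E.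
  rewrite ltey; apply/eqP => Iy.
  have := @potential_ge R n mu B p theta s (eucl_norm \o g) j k x jk.
  by rewrite Iy mulry gtr0_sg// mul1e sE.
have IE : energy mu B p (eucl_norm \o g) k x =
    (fine (energy mu B p (eucl_norm \o g) k x))%:E.
  by rewrite fineK// ge0_fin_numE.
rewrite {1}IE {1}sE -EFinM lee_fin => wI.
have := poincare fg (r := rad k) Ex.
rewrite dyadic_radius_gt0 dyadic_radius_lt2 => /(_ isT)/=.
rewrite -/(dyadic_ball B k x) -/(energy mu B p (eucl_norm \o g) k x).
rewrite IE mE inver gt_eqF// -EFinM lee_pdivrMl// -EFinM.
move=> P; have Q := dyadic_average_dist_le (avg f k x) Ex Ey Dyx fp.
rewrite -lee_fin; apply: (le_trans Q).
apply: (le_trans (lee_wpmul2l _ P)).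
  by rewrite lee_fin invr_ge0 ltW.
rewrite -EFinM lee_fin; apply: (@step_bound _ (rad l)) => //;
  rewrite ?fine_ge0 ?dyadic_radius_le4//.
Qed.

Lemma trace_op_lim f x l : avg f ^~ x @ \oo --> l -> T f x = l.
Proof.
move=> fl; have cf : cvgn (avg f ^~ x) by apply/cvg_ex; exists l.
rewrite /trace_op is_cvg_limn_esupE.
  by rewrite (EFin_lim cf)/=; exact/cvg_lim.
by apply/cvg_ex; exists l%:E; apply: cvg_EFin => //; exact: nearW.
Qed.

(** A limit superior is not additive, so the averages of both functions are assumed to converge at
    the point. *)
Lemma trace_op_linear a u v x : E x -> Lp mu B p u -> Lp mu B p v ->
  avg u ^~ x @ \oo --> T u x -> avg v ^~ x @ \oo --> T v x ->
  T (fun y => a * u y + v y) x = a * T u x + T v x.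
Proof.
move=> Ex up vp cu cv; apply: trace_op_lim.
rewrite (_ : _ ^~ x = (cst a \* (avg u ^~ x)) \+ (avg v ^~ x)).
  have ca : cst a @ \oo --> a by exact: cvg_cst.
  exact: cvgD (cvgM ca cu) cv.
apply/funext => k; have [mE _ _] := dyadic_measure k Ex.
have moo : (mu (D k x) < +oo)%E by rewrite mE ltry.
have mD : measurable (D k x) by exact: measurable_dyadic_ball.
have iu : mu.-integrable (D k x) (EFin \o u).
  by apply: Lp_integrable => //; exact: subIsetr.
have iv : mu.-integrable (D k x) (EFin \o v).
  by apply: Lp_integrable => //; exact: subIsetr.
rewrite /= /dyadic_average /average RintegralD//; last first.
  exact: (integrableZl mD a iu).
by rewrite RintegralZl// mulrDr mulrCA.
Qed.

(** Once the ball lies in [U], its average differs from f(x) by at most |L| times the radius. *)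
Lemma trace_op_lipschitz f (U : set 'rV[R]_n) x : Lp mu B p f -> open U ->
  E `<=` U -> eucl_lipschitz U f -> E x -> T f x = f x.
Proof.
move=> fp oU EU [L fL] Ex; apply: trace_op_lim.
have Ux : U x by exact: EU.
have [d d0 dU] := nbhs_eucl_ball (open_nbhs_nbhs (conj oU Ux)).
have rad0 : rad @ \oo --> (0 : R).
  rewrite -[X in _ --> X](mulr0 (3 / 2)); apply: cvgM; first exact: cvg_cst.
  by apply: cvg_expr; rewrite ger0_norm ?invr_ge0// invf_lt1 ?ltr1n.
apply/cvgrPdist_le => e e0; near=> k.
have [mE _ _] := dyadic_measure k Ex; have m0 := dyadic_measure_gt0 k Ex.
have r0 := @dyadic_radius_gt0 R k.
have rd : rad k < d by near: k; exact: cvgr_lt rad0 _ d0.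
(* [L] may be zero or negative; the added 1 gives a positive divisor. *)
have re : (`|L| + 1) * rad k <= e.
  rewrite mulrC -ler_pdivlMr ?ltr_wpDl//; near: k.
  by apply: cvgr_le rad0 _ _; rewrite divr_gt0// ltr_wpDl.
rewrite distrC -lee_fin; apply: (le_trans
  (dyadic_average_dist_le (f x) Ex Ex (@subset_refl _ (D k x)) fp)).
apply: (@le_trans _ _ ((fine (mu (D k x)))^-1%:E *
    \int[mu]_(z in D k x) cst e%:E z)%E).
  rewrite lee_pmul2l ?lte_fin ?invr_gt0//; apply: le_integral_subset => //.
  - by move=> z _ /=; rewrite lee_fin ltW.
  - move=> z [xz Bz] /=; rewrite lee_fin; apply: le_trans re.
    apply: (le_trans (fL _ _ _ Ux)).
      by apply: dU; apply: lt_trans rd.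
    apply: (@le_trans _ _ (`|L| * eucl_dist z x)).
      by rewrite ler_wpM2r ?eucl_dist_ge0// ler_norm.
    rewrite eucl_distC ler_pM ?eucl_dist_ge0//; first by rewrite lerDl.
    exact: ltW.
rewrite integral_cst; last exact: measurable_dyadic_ball.
rewrite [X in (_ * X)%E](_ : _ = (e * fine (mu (D k x)))%:E); last first.
  by rewrite EFinM -mE.
by rewrite -EFinM lee_fin mulrCA mulVf ?mulr1// gt_eqF.
Unshelve. all: by end_near. Qed.

Let tq : R := 2^-1 `^ theta.

Let tq01 : 0 <= tq < 1.
Proof. by apply: powR_half_lt1; case/andP: theta01. Qed.

Let K2 := K1 / (1 - tq).

Let K2_ge0 : 0 <= K2.
Proof. by rewrite divr_ge0// subr_ge0 ltW//; case/andP: tq01. Qed.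

Let dyadic_average_cvg f g x j : sobolev mu B p f g -> E x ->
  (S (eucl_norm \o g) j x < +oo)%E ->
  avg f ^~ x @ \oo --> T f x /\
  `|T f x - avg f j x| <=
    K2 * rad j `^ theta * fine (S (eucl_norm \o g) j x) `^ p^-1.
Proof.
move=> fg Ex Soo; set sg := fine (S (eucl_norm \o g) j x) `^ p^-1.
have step i : `|avg f (j + i.+1) x - avg f (j + i) x| <=
    K1 * rad j `^ theta * sg * tq ^+ i.
  have -> : K1 * rad j `^ theta * sg * tq ^+ i =
      K1 * rad (j + i) `^ theta * sg by rewrite powR_dyadic_radiusD -/tq; ring.
  apply: (dyadic_step fg) => //; first exact: leq_addr.
    by rewrite addnS ltnW.
  apply: setSI; apply: eucl_ball_sub; rewrite eucl_distxx add0r.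
  by apply: dyadic_radius_le; rewrite addnS.
have [l cl hl] := cvg_geometric_increments tq01 step.
have {}cl : avg f ^~ x @ \oo --> l.
  by rewrite -(cvg_shiftn j); under eq_fun do rewrite addnC.
rewrite (trace_op_lim cl); split=> //.
rewrite addn0 in hl; apply: (le_trans hl).
by rewrite /K2 le_eqVlt; apply/orP; left; apply/eqP; ring.
Qed.

Let K3 := K1 + K2.

(** The chain runs through level j at x, level j+2 at y and level j at y. The ball at y is shrunk to
    fit inside the level-j ball around x; returning to level j at y costs one more step between
    concentric balls. *)
Let trace_op_dist f g x y j : sobolev mu B p f g -> E x -> E y ->
  eucl_dist x y <= 2^-1 ^+ j ->
  (S (eucl_norm \o g) j x < +oo)%E -> (S (eucl_norm \o g) j y < +oo)%E ->
  `|T f x - T f y| <= K3 * rad j `^ theta *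
    (fine (S (eucl_norm \o g) j x) `^ p^-1 + fine (S (eucl_norm \o g) j y) `^ p^-1).
Proof.
move=> fg Ex Ey xy Sx Sy.
have [_ hx] := dyadic_average_cvg fg Ex Sx.
have [_ hy] := dyadic_average_cvg fg Ey Sy.
have jj2 : (j <= j.+2)%N by rewrite -addn2 leq_addr.
have rj2 : rad j.+2 <= rad j by exact: dyadic_radius_le.
have hxy := @dyadic_step f g x y j j j.+2 fg Ex Ey (leqnn _) (leqnn _).
have hyy := @dyadic_step f g y y j j j.+2 fg Ey Ey (leqnn _) (leqnn _).
have {}hxy := hxy _ Sx; have {}hyy := hyy _ Sy.
have {}hxy : `|avg f j.+2 y - avg f j x| <= K1 * rad j `^ theta *
    fine (S (eucl_norm \o g) j x) `^ p^-1.
  apply: hxy; apply: setSI; apply: eucl_ball_sub.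
  exact: dyadic_radius_slack.
have {}hyy : `|avg f j.+2 y - avg f j y| <= K1 * rad j `^ theta *
    fine (S (eucl_norm \o g) j y) `^ p^-1.
  apply: hyy; apply: setSI; apply: eucl_ball_sub.
  by rewrite eucl_distxx add0r.
apply: (le_trans (ler_dist4 _ (avg f j x) (avg f j.+2 y) (avg f j y) _)).
apply: (le_trans (lerD (lerD (lerD hx hxy) hyy) hy)).
have sumE (k1 k2 r a b : R) :
  k2 * r * a + k1 * r * a + k1 * r * b + k2 * r * b = (k1 + k2) * r * (a + b).
  by ring.
by rewrite sumE.
Qed.

Let powR_potential (g : 'rV[R]_n -> 'rV[R]_n) x j : (S (eucl_norm \o g) j x < +oo)%E ->
  S (eucl_norm \o g) j x =
  ((fine (S (eucl_norm \o g) j x) `^ p^-1) `^ p)%:E.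
Proof.
move=> Soo; have S0 := @potential_ge0 R n mu B p theta s (eucl_norm \o g) j x.
rewrite -powRrM mulVf ?gt_eqF// powRr1; last exact: fine_ge0.
by rewrite fineK// ge0_fin_numE.
Qed.

(** The added 1 makes the constant positive, so that it times an infinite potential is infinite and
    not 0 by convention. As K2 <= K3 + 1, it also serves the one-point bound. *)
Let K4 := (2 * (K3 + 1)) `^ p.

Let K4_gt0 : 0 < K4.
Proof. by rewrite powR_gt0// mulr_gt0// ltr_wpDl// addr_ge0. Qed.

Let powR_dist_bound t r a b : 0 <= t -> 0 <= r -> 0 <= a -> 0 <= b ->
  t <= K3 * r * (a + b) -> t `^ p <= K4 * r `^ p * (a `^ p + b `^ p).
Proof.
move=> t0 r0 a0 b0 h.
have K30 : 0 <= K3 + 1 by rewrite !addr_ge0.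
apply: (@le_trans _ _ (((K3 + 1) * r * (a + b)) `^ p)).
  apply: ge0_ler_powR; rewrite ?nnegrE ?(ltW p0)//.
    by apply: mulr_ge0; rewrite ?addr_ge0// mulr_ge0.
  apply: (le_trans h); rewrite ler_wpM2r ?addr_ge0// ler_wpM2r//.
  by rewrite lerDl.
rewrite powRM ?addr_ge0 ?mulr_ge0// powRM// /K4 (powRM _ _ K30)//.
apply: (@le_trans _ _ ((K3 + 1) `^ p * r `^ p * (2 `^ p * (a `^ p + b `^ p)))).
  by rewrite ler_wpM2l ?mulr_ge0 ?powR_ge0// powRD_le// ltW.
by rewrite le_eqVlt; apply/orP; left; apply/eqP; ring.
Qed.

Let powR_trace_bound t c r a : 0 <= t -> 0 <= c -> 0 <= r -> 0 <= a ->
  t <= c + K2 * r * a -> t `^ p <= 2 `^ p * c `^ p + K4 * r `^ p * a `^ p.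
Proof.
move=> t0 c0 r0 a0 h.
have K30 : 0 <= K3 + 1 by rewrite !addr_ge0.
apply: (@le_trans _ _ ((c + (K3 + 1) * r * a) `^ p)).
  apply: ge0_ler_powR; rewrite ?nnegrE ?(ltW p0)//.
    by rewrite addr_ge0// mulr_ge0// mulr_ge0.
  rewrite (le_trans h)// lerD2l ler_wpM2r// ler_wpM2r//.
  by rewrite /K3 addrAC lerDr addr_ge0.
apply: (le_trans (powRD_le (ltW p0) c0 _)); first by rewrite mulr_ge0// mulr_ge0.
rewrite mulrDr lerD2l powRM ?mulr_ge0// powRM// /K4 (powRM _ _ K30)//.
by rewrite le_eqVlt; apply/orP; left; apply/eqP; ring.
Qed.

Let trace_op_dist_powR f g x y j : sobolev mu B p f g -> E x -> E y ->
  eucl_dist x y <= 2^-1 ^+ j ->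
  ((`|T f x - T f y| `^ p)%:E <= (K4 * rad j `^ (theta * p))%:E *
    (S (eucl_norm \o g) j x + S (eucl_norm \o g) j y))%E.
Proof.
move=> fg Ex Ey xy.
have S0 z := @potential_ge0 R n mu B p theta s (eucl_norm \o g) j z.
have c0 : 0 < K4 * rad j `^ (theta * p).
  by apply: mulr_gt0 => //; apply: powR_gt0; exact: dyadic_radius_gt0.
have [Sx|] := ltP (S (eucl_norm \o g) j x) +oo%E; last first.
  rewrite leye_eq => /eqP ->; rewrite addye ?gt_eqF// ?(lt_le_trans _ (S0 y))//.
  by rewrite mulry gtr0_sg// mul1e leey.
have [Sy|] := ltP (S (eucl_norm \o g) j y) +oo%E; last first.
  rewrite leye_eq => /eqP ->; rewrite addey ?gt_eqF// ?(lt_le_trans _ (S0 x))//.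
  by rewrite mulry gtr0_sg// mul1e leey.
have h := trace_op_dist fg Ex Ey xy Sx Sy.
rewrite (powR_potential Sx) (powR_potential Sy) -EFinD -EFinM lee_fin powRrM.
by apply: powR_dist_bound h; rewrite ?normr_ge0 ?powR_ge0.
Qed.

Let trace_op_powR f g x : sobolev mu B p f g -> E x ->
  ((`|T f x| `^ p)%:E <= (2 `^ p * `|avg f 0 x| `^ p)%:E +
    (K4 * rad 0 `^ (theta * p))%:E * S (eucl_norm \o g) 0 x)%E.
Proof.
move=> fg Ex.
have c0 : 0 < K4 * rad 0 `^ (theta * p).
  by apply: mulr_gt0 => //; apply: powR_gt0; exact: dyadic_radius_gt0.
have [Sx|] := ltP (S (eucl_norm \o g) 0 x) +oo%E; last first.
  rewrite leye_eq => /eqP ->.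
  by rewrite mulry gtr0_sg// mul1e addey ?leey.
have [_ h] := dyadic_average_cvg fg Ex Sx.
rewrite (powR_potential Sx) -EFinM -EFinD lee_fin powRrM.
apply: powR_trace_bound; rewrite ?normr_ge0 ?powR_ge0//.
by rewrite -lerBlDl; apply: le_trans h; exact: lerB_dist.
Qed.

Lemma trace_op_pointwise : exists2 K, 0 < K & forall f g, sobolev mu B p f g ->
  [/\ forall x, E x -> (S (eucl_norm \o g) 0 x < +oo)%E ->
        avg f ^~ x @ \oo --> T f x,
      forall x, E x -> ((`|T f x| `^ p)%:E <= (2 `^ p * `|avg f 0 x| `^ p)%:E +
        (K * rad 0 `^ (theta * p))%:E * S (eucl_norm \o g) 0 x)%E &
      forall x y j, E x -> E y -> eucl_dist x y <= 2^-1 ^+ j ->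
        ((`|T f x - T f y| `^ p)%:E <= (K * rad j `^ (theta * p))%:E *
          (S (eucl_norm \o g) j x + S (eucl_norm \o g) j y))%E].
Proof.
exists K4 => // f g fg; split.
- by move=> x Ex Sx; have [] := dyadic_average_cvg fg Ex Sx.
- by move=> x Ex; exact: trace_op_powR.
- by move=> x y j Ex Ey; exact: trace_op_dist_powR.
Qed.

(** Hölder's inequality through [integral_norm_interp]: with lam^p about M, the integral of |f| is
    at most lam m + lam^(1-p) M, about lam (m + 1). Division by m gives c lam, because 1/m <= Cm /
    r^s. *)
Lemma dyadic_average_powR_le : exists2 K, 0 <= K & forall f x, Lp mu B p f ->
  E x -> ((`|avg f 0 x| `^ p)%:E <= K%:E * \int[mu]_(z in B) (`|f z| `^ p)%:E)%E.
Proof.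
have r0 := @dyadic_radius_gt0 R 0.
pose c := 1 + Cm / rad 0 `^ s.
have c0 : 0 < c.
  by rewrite addr_gt0// divr_gt0// powR_gt0.
exists (c `^ p) => [|f x fp Ex]; first exact: powR_ge0.
have [mE m1 _] := dyadic_measure 0 Ex; have m0 := dyadic_measure_gt0 0 Ex.
set m := fine (mu _) in mE m1 m0.
have mD : measurable (D 0 x) by exact: measurable_dyadic_ball.
set M := (\int[mu]_(z in B) _)%E.
have M0 : (0 <= M)%E by apply: integral_ge0 => z _; rewrite lee_fin powR_ge0.
have [Moo|] := ltP M +oo%E; last first.
  rewrite leye_eq => /eqP ->; rewrite mulry gtr0_sg ?powR_gt0// mul1e.
  by rewrite leey.
have ME : M = (fine M)%:E by rewrite fineK// ge0_fin_numE.
have mf : measurable_fun (D 0 x) f.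
  apply: (measurable_funS mB (@subIsetr _ _ _)).
  by apply/(measurable_restrictT _ mB); exact: Lp_measurable fp.
(* The margin e keeps [lam] positive when M = 0; it is divided by c^p since the final bound is (c
   lam)^p. *)
rewrite ME -EFinM lee_fin; apply/ler_addgt0Pr => e e0.
have cp0 : 0 < c `^ p by exact: powR_gt0.
have Me0 : 0 < fine M + e / c `^ p by rewrite ltr_wpDl ?fine_ge0// divr_gt0.
have [lam lam0 lamp] : exists2 lam, 0 < lam & lam `^ p = fine M + e / c `^ p.
  exists ((fine M + e / c `^ p) `^ p^-1); first exact: powR_gt0.
  by rewrite -powRrM mulVf ?gt_eqF// powRr1// ltW.
have intf : (\int[mu]_(z in D 0 x) `|f z|%:E <= (lam * (m + 1))%:E)%E.
  apply: (le_trans (integral_norm_interp mu mD mf (ltW p1) lam0)).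
  rewrite mulrDr mulr1 EFinD leeD//; first by rewrite EFinM -mE.
  apply: (@le_trans _ _ ((lam `^ (1 - p))%:E * (lam `^ p)%:E)%E).
    apply: lee_wpmul2l; first by rewrite lee_fin powR_ge0.
    apply: (@le_trans _ _ M).
      by apply: le_integral_subset => [z []|z _|z _|z _]//;
        rewrite lee_fin powR_ge0.
    by rewrite ME lamp lee_fin lerDl divr_ge0// ltW.
  rewrite -EFinM lee_fin -powRD ?(gt_eqF lam0) ?implybT//.
  by rewrite subrK powRr1// ltW.
have := dyadic_average_dist_le 0 Ex Ex (@subset_refl _ (D 0 x)) fp.
under eq_integral do rewrite subr0; rewrite subr0 => h.
have {}h : `|avg f 0 x| <= c * lam.
  rewrite -lee_fin; apply: (le_trans h).
  apply: (le_trans (lee_wpmul2l _ intf)); first by rewrite lee_fin invr_ge0 ltW.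
  rewrite -EFinM lee_fin mulrCA mulrC ler_wpM2r ?(ltW lam0)//.
  rewrite -/m mulrDr mulVf ?gt_eqF// mulr1 lerD2l.
  rewrite -[leRHS]invrK invf_div lef_pV2 ?posrE ?divr_gt0 ?powR_gt0//.
  by rewrite mulrC.
apply: (@le_trans _ _ ((c * lam) `^ p)).
  by apply: ge0_ler_powR; rewrite ?nnegrE ?mulr_ge0 ?(ltW p0) ?(ltW c0) ?(ltW lam0).
rewrite powRM ?(ltW c0) ?(ltW lam0)// lamp mulrDr lerD2l.
by rewrite mulrCA mulfV ?mulr1// gt_eqF.
Qed.

End trace_pointwise.

(** * Measurability of the averages and of the trace *)

Section trace_measurability.
Context {R : realType} {n : nat}.
Variables (mu : {sigma_finite_measure set 'rV[R]_n -> \bar R}).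
Variables (B : set 'rV[R]_n).
Hypotheses (mB : measurable B).

Local Notation rad := (@dyadic_radius R).
Local Notation D := (dyadic_ball B).

Let measurable_dyadic_integral (phi : 'rV[R]_n -> \bar R) k :
  measurable_fun setT (phi \_ B) -> (forall x, (0 <= phi x)%E) ->
  measurable_fun setT (fun x => \int[mu]_(z in D k x) phi z)%E.
Proof.
move=> mphi phi0.
rewrite (_ : (fun x => _) = fun x => (\int[mu]_(z in eucl_ball x (rad k)) (phi \_ B) z)%E).
  by apply: measurable_ball_integral => // x; exact: erestrict_ge0.
by apply/funext => x; rewrite integral_mkcondr.
Qed.

Lemma measurable_dyadic_average f k : measurable_fun setT (f \_ B) ->
  measurable_fun setT (dyadic_average mu B f k).
Proof.
move=> mf; have mfB : measurable_fun B (EFin \o f).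
  by apply/measurable_EFinP; apply/(measurable_restrictT _ mB).
pose m x := (\int[mu]_(z in D k x) cst 1 z)%E.
pose I x := (\int[mu]_(z in D k x) (EFin \o f)^\+ z -
  \int[mu]_(z in D k x) (EFin \o f)^\- z)%E.
(* The measure of the ball is the integral of 1, and its inverse is its power -1, also at 0, so
   measurability of powers applies. *)
have -> : dyadic_average mu B f k =
    ((fun x : R => powR x (-1)) \o (fine \o m)) \* (fine \o I).
  apply/funext => x; rewrite /= /m /I -integralE integral_cst ?mul1e.
    by rewrite powR_inv1 ?fine_ge0.
  exact: measurable_dyadic_ball.
apply: measurable_funM.
  apply: (measurableT_comp (measurable_powR _)).
  apply: (measurableT_comp (fine_measurable measurableT)) => //.
  apply: measurable_dyadic_integral => //.
  by apply/(measurable_restrictT _ mB); exact: measurable_cst.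
apply: (measurableT_comp (fine_measurable measurableT)) => //.
apply: emeasurable_funB; apply: measurable_dyadic_integral => //;
  apply/(measurable_restrictT _ mB).
- exact: measurable_funepos.
- exact: measurable_funeneg.
Qed.

Lemma measurable_trace_op f : measurable_fun setT (f \_ B) ->
  measurable_fun setT (trace_op mu B f).
Proof.
move=> mf; rewrite (_ : trace_op mu B f = fine \o
    (fun x => limn_esup (fun k => (dyadic_average mu B f k x)%:E)))//.
apply: (measurableT_comp (fine_measurable measurableT)) => //.
apply: measurable_fun_limn_esup => k; apply/measurable_EFinP.
exact: measurable_dyadic_average.
Qed.

Lemma trace_op_ae_eq u v :
  measurable_fun setT (u \_ B) -> measurable_fun setT (v \_ B) ->
  {ae mu, forall x, B x -> u x = v x} -> trace_op mu B u = trace_op mu B v.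
Proof.
move=> mu_ mv uv; apply/funext => x; congr (fine (limn_esup _)).
apply/funext => k; congr (_%:E); congr (_ * fine _).
apply: ae_eq_integral.
- exact: measurable_dyadic_ball.
- apply/measurable_EFinP; apply: (measurable_funS mB (@subIsetr _ _ _)).
  exact/(measurable_restrictT _ mB).
- apply/measurable_EFinP; apply: (measurable_funS mB (@subIsetr _ _ _)).
  exact/(measurable_restrictT _ mB).
- by apply: filterS uv => z uvz [_ Bz]; rewrite uvz.
Qed.

End trace_measurability.
(** * Besov and Lebesgue norms of the trace *)

Section besov_estimate.
Context {R : realType} {n : nat}.
Variables (nu : {sigma_finite_measure set 'rV[R]_n -> \bar R}).
Variables (E : set 'rV[R]_n) (p theta Q C c : R).
Hypotheses (p1 : 1 < p) (theta0 : 0 < theta) (Q0 : 0 < Q).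
Hypotheses (C0 : 0 <= C) (c0 : 0 < c).
Hypothesis nu_upper :
  forall x r, 0 < r -> (nu (eucl_ball x r) <= (C * r `^ Q)%:E)%E.
Hypothesis nu_lower : forall x y, E x -> E y -> x <> y ->
  ((c * eucl_dist x y `^ Q)%:E <= nu (eucl_ball x (eucl_dist x y)))%E.
Hypothesis E1 : forall x y, E x -> E y -> eucl_dist x y <= 1.

Local Notation rad := (@dyadic_radius R).

Lemma dyadic_scale (d : R) : 0 < d -> d <= 1 ->
  exists j, d <= 2^-1 ^+ j /\ rad j <= 3 * d.
Proof.
move=> d0 d1.
have ex : exists k, (2^-1 : R) ^+ k < d.
  have cz : (fun k => (2^-1 : R) ^+ k) @ \oo --> (0 : R).
    by apply: cvg_expr; rewrite ger0_norm ?invr_ge0// invf_lt1 ?ltr1n.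
  have [N _ hN] : \forall k \near \oo, (2^-1 : R) ^+ k < d.
    exact: cvgr_lt cz _ d0.
  by exists N; exact: (hN N (leqnn N)).
(* The scale is the predecessor of the least k with 2^-k < d; d <= 1 excludes k = 0. Then rad j = 3
   * 2^-(j+1) < 3d. *)
case: (ex_minnP ex) => -[|j] hj jmin.
  by move: hj; rewrite expr0 ltNge d1.
exists j; split.
  by rewrite leNgt; apply/negP => /jmin; rewrite ltnn.
move: hj; rewrite /dyadic_radius exprSr.
by move: (2^-1 ^+ j) => t; lra.
Qed.

(** [S] and [t] abstract the potentials and the trace; [A] and [q] give the geometric decay of the
    integrals of the potentials. *)
Variables (S : nat -> 'rV[R]_n -> \bar R) (t : 'rV[R]_n -> R) (K A q : R).
Hypotheses (K0 : 0 <= K) (q01 : 0 <= q < 1).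
Hypothesis mS : forall j, measurable_fun setT (S j).
Hypothesis S0 : forall j x, (0 <= S j x)%E.
Hypothesis intS : forall j, (\int[nu]_x S j x <= (A * q ^+ j)%:E)%E.
Hypothesis dist_t : forall x y j, E x -> E y -> eucl_dist x y <= 2^-1 ^+ j ->
  ((`|t x - t y| `^ p)%:E <= (K * rad j `^ (theta * p))%:E * (S j x + S j y))%E.

Let p0 : 0 < p. Proof. exact: lt_trans p1. Qed.

(** From d >= rad j / 3 the kernel's denominator is at least c (rad j / 3)^(theta p + Q). Its power
    theta p cancels the one in [dist_t], leaving rad j to the power -Q. *)
Let w j := K * 3 `^ (theta * p) * 3 `^ Q / c * rad j `^ (- Q).

Let w0 j : 0 <= w j.
Proof.
by rewrite mulr_ge0 ?powR_ge0// divr_ge0 ?(ltW c0)// mulr_ge0 ?powR_ge0//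
  mulr_ge0 ?powR_ge0.
Qed.

Let f j x y := ((w j)%:E * (S j x + S j y))%E.

Let f0 j x y : (0 <= f j x y)%E.
Proof. by rewrite mule_ge0 ?lee_fin// adde_ge0. Qed.

Let term j x := f j x \_ (eucl_ball x (rad j)).

Let term0 j x y : (0 <= term j x y)%E.
Proof. by apply: erestrict_ge0 => z _; exact: f0. Qed.

Let mf j x : measurable_fun setT (f j x).
Proof.
apply: measurable_funeM; apply: emeasurable_funD => //; exact: measurable_cst.
Qed.

Let kernel x y : \bar R := ((`|t y - t x| `^ p)%:E /
  ((eucl_dist x y `^ (theta * p))%:E * nu (eucl_ball x (eucl_dist x y))))%E.

Let kernel_ge0 x y : (0 <= kernel x y)%E.
Proof.
rewrite mule_ge0// ?lee_fin ?powR_ge0// inve_ge0 mule_ge0// lee_fin.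
exact: powR_ge0.
Qed.

(** The term at the scale of d(x, y) alone dominates the kernel. Cutting off by full balls instead
    of annuli keeps every domain a ball, and the sum over j still converges. *)
Let kernel_le x y : E x -> E y -> (kernel x y <= \sum_(j <oo) term j x y)%E.
Proof.
move=> Ex Ey; have sum0 : (0 <= \sum_(j <oo) term j x y)%E.
  by apply: nneseries_ge0 => k _ _.
(* On the diagonal the numerator 0^p vanishes, and so does the quotient whatever the denominator. *)
have [<-|/eqP xy] := eqVneq x y.
  rewrite /kernel subrr normr0 powR0 ?gt_eqF// mul0e.
  by apply: nneseries_ge0 => k _ _.
set d := eucl_dist x y.
have d0 : 0 < d.
  by rewrite lt0r eucl_dist_ge0 andbT; apply/eqP => /eucl_dist_eq0.
have [j [dj rj]] := dyadic_scale d0 (E1 Ex Ey).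
have r0 := @dyadic_radius_gt0 R j.
apply: (@le_trans _ _ (term j x y)); last first.
  have h k : (0 <= k)%N -> true -> (0 <= term k x y)%E by [].
  apply: le_trans (nneseries_lim_ge j.+1 h).
  by rewrite big_nat_recr//= leeDr// sume_ge0.
rewrite /term patchE mem_set; last first.
  rewrite /eucl_ball/=; apply: (le_lt_trans dj); rewrite /dyadic_radius.
  by rewrite ltr_pMl ?exprn_gt0 ?invr_gt0// ltr_pdivlMr// mul1r ltr_nat.
pose a := d `^ (theta * p) * (c * d `^ Q).
have a0 : 0 < a by rewrite !mulr_gt0// powR_gt0.
have inva : a^-1 <= 3 `^ (theta * p) * 3 `^ Q / c * rad j `^ (- Q) *
    rad j `^ (- (theta * p)).
  have rd e : 0 <= e -> rad j `^ e <= 3 `^ e * d `^ e.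
    move=> e0; rewrite -powRM// ?(ltW d0)//.
    by apply: ge0_ler_powR; rewrite ?nnegrE ?mulr_ge0 ?(ltW d0) ?(ltW r0).
  have -> : 3 `^ (theta * p) * 3 `^ Q / c * rad j `^ (- Q) * rad j `^ (- (theta * p)) =
     ((c / (3 `^ (theta * p) * 3 `^ Q)) * (rad j `^ Q * rad j `^ (theta * p)))^-1.
    by rewrite !powRN; field; rewrite !gt_eqF ?powR_gt0.
  rewrite lef_pV2 ?posrE//; last by rewrite !mulr_gt0 ?invr_gt0 ?mulr_gt0 ?powR_gt0.
  rewrite mulrAC ler_pdivrMr ?mulr_gt0 ?powR_gt0//.
  have -> : a * (3 `^ (theta * p) * 3 `^ Q) =
    c * ((3 `^ Q * d `^ Q) * (3 `^ (theta * p) * d `^ (theta * p))).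
    by rewrite /a; ring.
  rewrite ler_pM2l// ler_pM ?powR_ge0// rd// ?(ltW Q0)// mulr_ge0 ?ltW//.
apply: (@le_trans _ _ ((`|t y - t x| `^ p)%:E * a^-1%:E)%E).
  rewrite lee_wpmul2l ?lee_fin ?powR_ge0//.
  have -> : (a^-1%:E = a%:E^-1)%E by rewrite inver gt_eqF.
  rewrite lee_pV2 ?inE ?lee_fin ?(ltW a0)//.
    by rewrite /a EFinM lee_wpmul2l ?lee_fin ?powR_ge0// nu_lower.
  by rewrite mule_ge0// lee_fin powR_ge0.
rewrite distrC muleC.
apply: (le_trans (lee_wpmul2l _ (dist_t Ex Ey dj))).
  by rewrite lee_fin invr_ge0 ltW.
rewrite muleA -EFinM; apply: lee_wpmul2r; first exact: adde_ge0.
rewrite lee_fin /w.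
apply: (le_trans (ler_wpM2r _ inva)); first by rewrite mulr_ge0// powR_ge0.
rewrite le_eqVlt; apply/orP; left; apply/eqP.
have rr : rad j `^ (- (theta * p)) * rad j `^ (theta * p) = 1.
  by rewrite powRN mulVf// gt_eqF ?powR_gt0.
rewrite (_ : K * _ * _ / c * _ = K * 3 `^ (theta * p) * 3 `^ Q / c * rad j `^ (- Q) *
  (rad j `^ (- (theta * p)) * rad j `^ (theta * p))); last by rewrite rr mulr1.
ring.
Qed.

(** Bound for the integral of [term j x]: S_j(x) is constant in y and picks up the measure of the
    ball. Integrated in x and swapped, the other summand takes the same form, whence the 2 in
    [G_int]; the powers of rad j cancel. *)
Let G j x := ((w j)%:E * ((C * rad j `^ Q)%:E * S j x +
  \int[nu]_(y in eucl_ball x (rad j)) S j y))%E.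

Let ball_int0 j x : (0 <= \int[nu]_(y in eucl_ball x (rad j)) S j y)%E.
Proof. by apply: integral_ge0 => y _. Qed.

Let Cr0 j : 0 <= C * rad j `^ Q.
Proof. by rewrite mulr_ge0 ?powR_ge0. Qed.

Let G0 j x : (0 <= G j x)%E.
Proof. by rewrite mule_ge0 ?lee_fin// adde_ge0// mule_ge0 ?lee_fin. Qed.

Let mball j : measurable_fun setT
  (fun x => \int[nu]_(y in eucl_ball x (rad j)) S j y)%E.
Proof. exact: measurable_ball_integral. Qed.

Let term_int j x : (\int[nu]_y term j x y <= G j x)%E.
Proof.
have mB := @measurable_eucl_ball R n x (rad j).
have msub (h : 'rV[R]_n -> \bar R) :
  measurable_fun setT h -> measurable_fun (eucl_ball x (rad j)) h.
  exact: measurable_funTS.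
rewrite -integral_mkcond /f ge0_integralZl//; last 3 first.
- by apply: msub; apply: emeasurable_funD => //; exact: measurable_cst.
- by move=> y _; exact: adde_ge0.
- by rewrite lee_fin.
rewrite /G lee_wpmul2l ?lee_fin// ge0_integralD//; last exact: msub.
rewrite integral_cst// leeD2r// muleC lee_wpmul2r//.
by apply: nu_upper; exact: dyadic_radius_gt0.
Qed.

Let G_int j : (\int[nu]_x G j x <=
  (2 * K * 3 `^ (theta * p) * 3 `^ Q / c * C * A * q ^+ j)%:E)%E.
Proof.
have mSj := mS j.
have mCS : measurable_fun setT (fun x => (C * rad j `^ Q)%:E * S j x)%E.
  exact: measurable_funeM.
rewrite ge0_integralZl//; last 3 first.
- exact: emeasurable_funD.
- by move=> x _; rewrite adde_ge0// mule_ge0 ?lee_fin.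
- by rewrite lee_fin.
rewrite ge0_integralD//; last by move=> x _; rewrite mule_ge0 ?lee_fin.
rewrite ge0_integralZl//; last by rewrite lee_fin.
rewrite (ball_integral_swap nu nu (rad j) mSj (S0 j)).
have h : (\int[nu]_y (S j y * nu (eucl_ball y (rad j))) <=
    (C * rad j `^ Q)%:E * \int[nu]_x S j x)%E.
  rewrite -ge0_integralZl//; last by rewrite lee_fin.
  apply: le_integral_subset => // y _; first exact: mule_ge0.
    by rewrite mule_ge0 ?lee_fin.
  rewrite muleC lee_wpmul2r//; apply: nu_upper; exact: dyadic_radius_gt0.
apply: (@le_trans _ _ ((w j)%:E * ((C * rad j `^ Q)%:E * (A * q ^+ j)%:E +
    (C * rad j `^ Q)%:E * (A * q ^+ j)%:E))%E).
  rewrite lee_wpmul2l ?lee_fin// leeD//; first by rewrite lee_wpmul2l ?lee_fin.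
  by apply: (le_trans h); rewrite lee_wpmul2l ?lee_fin.
rewrite -!EFinM lee_fin le_eqVlt; apply/orP; left; apply/eqP.
have rr : rad j `^ (- Q) * rad j `^ Q = 1.
  by rewrite powRN mulVf// gt_eqF ?powR_gt0// dyadic_radius_gt0.
transitivity (2 * K * 3 `^ (theta * p) * 3 `^ Q / c * C * A * q ^+ j *
  (rad j `^ (- Q) * rad j `^ Q)); last by rewrite rr mulr1.
by rewrite /w; ring.
Qed.

Lemma besov_double_integral_le :
  (\int[nu]_(x in E) \int[nu]_(y in E)
    ((`|t y - t x| `^ p)%:E / ((eucl_dist x y `^ (theta * p))%:E *
      nu (eucl_ball x (eucl_dist x y)))) <=
   (2 * K * 3 `^ (theta * p) * 3 `^ Q / c * C * A / (1 - q))%:E)%E.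
Proof.
apply: (@le_trans _ _ (\int[nu]_x \sum_(j <oo) G j x)%E).
  apply: le_integral_subset => //.
  - by move=> x Ex; apply: integral_ge0 => y _; exact: kernel_ge0.
  - by move=> x _; apply: nneseries_ge0 => j _ _; exact: G0.
  move=> x Ex; apply: (@le_trans _ _ (\int[nu]_y \sum_(j <oo) term j x y)%E).
    apply: le_integral_subset => // [y Ey|y _|y Ey].
    - exact: kernel_ge0.
    - by apply: nneseries_ge0 => j _ _; exact: term0.
    - exact: kernel_le.
  rewrite integral_nneseries//; last first.
    move=> j; apply/(measurable_restrictT _ (measurable_eucl_ball _ _)).
    exact: measurable_funTS.
  apply: lee_nneseries => j _ //; first by move=> _; exact: integral_ge0.
rewrite integral_nneseries//; last first.
  move=> j; apply: measurable_funeM; apply: emeasurable_funD => //.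
  exact: measurable_funeM.
rewrite -eseries_geometric//; apply: lee_nneseries => j _ //.
by move=> _; apply: integral_ge0 => x _; exact: G0.
Qed.

End besov_estimate.

(** * Norm bounds of the trace and assembly of its properties *)

Section trace_theorem.
Context {R : realType} {n : nat}.
Variables (mu nu : {sigma_finite_measure set 'rV[R]_n -> \bar R}).
Variables (B E : set 'rV[R]_n) (p theta s Q Cm Cp C c : R).
Hypotheses (mB : measurable B) (mE : measurable E).
Hypotheses (p1 : 1 < p) (theta01 : 0 < theta < 1) (s0 : 0 < s) (Q0 : 0 < Q).
Hypothesis delta0 : 0 < (1 - theta) * p - s + Q.
Hypotheses (Cm1 : 1 <= Cm) (Cp0 : 0 <= Cp) (C0 : 0 <= C) (c0 : 0 < c).
Hypothesis codim : forall x r, E x -> 0 < r < 2 ->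
  ((Cm^-1 * r `^ s)%:E <= mu (eucl_ball x r `&` B) <= (Cm * r `^ s)%:E)%E.
Hypothesis poincare : forall f g, sobolev mu B p f g ->
  forall x r, E x -> 0 < r < 2 ->
  let A := eucl_ball x r `&` B in
  ((mu A)^-1 * \int[mu]_(y in A) `|f y - average mu A f|%:E <=
   (Cp * r)%:E * ((mu A)^-1 * \int[mu]_(y in A) (eucl_norm (g y) `^ p)%:E) `^ p^-1)%E.
Hypothesis nu_upper :
  forall x r, 0 < r -> (nu (eucl_ball x r) <= (C * r `^ Q)%:E)%E.
Hypothesis nu_lower : forall x y, E x -> E y -> x <> y ->
  ((c * eucl_dist x y `^ Q)%:E <= nu (eucl_ball x (eucl_dist x y)))%E.
Hypothesis nu_finite : (nu setT < +oo)%E.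
Hypothesis E1 : forall x y, E x -> E y -> eucl_dist x y <= 1.

Local Notation rad := (@dyadic_radius R).
Local Notation S := (potential mu B p theta s).
Local Notation T := (trace_op mu B).

Let p0 : 0 < p. Proof. exact: lt_trans p1. Qed.

Lemma Lp_norm_powR (m : {measure set 'rV[R]_n -> \bar R}) A f :
  (Lp_norm m A p f `^ p = \int[m]_(x in A) (`|f x| `^ p)%:E)%E.
Proof.
rewrite /Lp_norm (poweR_Lnorm _ _ (lt0r_neq0 p0)).
rewrite [RHS]integral_mkcond.
apply: eq_integral => x _; rewrite /= !patchE.
by case: ifPn => // _; rewrite normr0 powR0// gt_eqF.
Qed.

Lemma Lp_normE (m : {measure set 'rV[R]_n -> \bar R}) A f :
  (Lp_norm m A p f = (\int[m]_(x in A) (`|f x| `^ p)%:E) `^ p^-1)%E.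
Proof.
by rewrite -Lp_norm_powR -poweRrM mulfV ?gt_eqF// poweRe1// Lnorm_ge0.
Qed.

Lemma Lp_norm_ge0 (m : {measure set 'rV[R]_n -> \bar R}) A f :
  (0 <= Lp_norm m A p f)%E.
Proof. by rewrite Lp_normE poweR_ge0. Qed.

Lemma Lp_lty (m : {measure set 'rV[R]_n -> \bar R}) A f : Lp m A p f ->
  (\int[m]_(x in A) (`|f x| `^ p)%:E < +oo)%E.
Proof.
move=> fp; rewrite -Lp_norm_powR; apply: poweR_lty.
by move: fp; rewrite /Lp/= inE => /andP[_ /[!inE]].
Qed.

Let grad_energy (g : 'rV[R]_n -> 'rV[R]_n) :
  (\int[mu]_(z in B) (`|(eucl_norm \o g) z| `^ p)%:E =
  \int[mu]_(z in B) ((eucl_norm \o g) z `^ p)%:E)%E.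
Proof.
by apply: eq_integral => z _; rewrite ger0_norm//; exact: eucl_norm_ge0.
Qed.

Let delta := (1 - theta) * p - s + Q.
Let q : R := 2^-1 `^ delta.
Let A0 := C * (3 / 2) `^ delta / (1 - q).

Let q01 : 0 <= q < 1.
Proof. exact: powR_half_lt1. Qed.

Let A0_ge0 : 0 <= A0.
Proof.
rewrite divr_ge0 ?mulr_ge0 ?powR_ge0// subr_ge0 ltW//.
by case/andP: q01.
Qed.

Let potential_int (g : 'rV[R]_n -> 'rV[R]_n) j : Lp mu B p (eucl_norm \o g) ->
  (\int[nu]_x S (eucl_norm \o g) j x <=
   (A0 * q ^+ j)%:E * \int[mu]_(z in B) (`|(eucl_norm \o g) z| `^ p)%:E)%E.
Proof.
move=> gp; rewrite grad_energy.
apply: (integral_potential_le (Lp_measurable gp) p0 nu_upper C0) => //.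
by rewrite -grad_energy Lp_lty.
Qed.

(** Provides the set of full nu-measure on which the averages converge and the trace is linear. *)
Let potential_lty (g : 'rV[R]_n -> 'rV[R]_n) : Lp mu B p (eucl_norm \o g) ->
  {ae nu, forall x, (S (eucl_norm \o g) 0 x < +oo)%E}.
Proof.
move=> gp; have mS : measurable_fun setT (S (eucl_norm \o g) 0).
  exact: (measurable_potential mu theta s (Lp_measurable gp) p0).
have S0 x := @potential_ge0 R n mu B p theta s (eucl_norm \o g) 0 x.
have iS : nu.-integrable setT (S (eucl_norm \o g) 0).
  apply/integrableP; split => //.
  under eq_integral do rewrite gee0_abs//.
  apply: (le_lt_trans (potential_int 0 gp)).
  by rewrite lte_mul_pinfty ?Lp_lty// lee_fin mulr_ge0 ?exprn_ge0//; case/andP: q01.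
by apply: filterS (integrable_ae measurableT iS) => x /(_ I); rewrite ge0_fin_numE.
Qed.

Let besov_le : exists2 K, 0 <= K & forall u g, sobolev mu B p u g ->
  (besov_norm nu E p theta (T u) <= K%:E * Lp_norm mu B p (eucl_norm \o g))%E.
Proof.
have [K K0 hK] := trace_op_pointwise mB p1 theta01 s0 Cm1 Cp0 codim poincare.
pose Kb := 2 * K * 3 `^ (theta * p) * 3 `^ Q / c * C * A0 / (1 - q).
have q1 : 0 <= 1 - q by rewrite subr_ge0 ltW//; case/andP: q01.
have Kb0 : 0 <= Kb.
  rewrite divr_ge0// mulr_ge0// mulr_ge0// divr_ge0 ?(ltW c0)//.
  by rewrite mulr_ge0 ?powR_ge0// mulr_ge0 ?powR_ge0// mulr_ge0// ltW.
exists (Kb `^ p^-1); first exact: powR_ge0.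
move=> u g ug; have [up _ gp] := ug; have [_ _ dT] := hK _ _ ug.
rewrite Lp_normE; set N := (\int[mu]_(x in B) _)%E.
have N0 : (0 <= N)%E by apply: integral_ge0 => z _; rewrite lee_fin powR_ge0.
have NE : N = (fine N)%:E by rewrite fineK// ge0_fin_numE// Lp_lty.
have mS j : measurable_fun setT (S (eucl_norm \o g) j).
  exact: (measurable_potential mu theta s (Lp_measurable gp) p0).
have S0 j x := @potential_ge0 R n mu B p theta s (eucl_norm \o g) j x.
have fN0 : 0 <= fine N by exact: fine_ge0.
have iS j : (\int[nu]_x S (eucl_norm \o g) j x <= (A0 * fine N * q ^+ j)%:E)%E.
  by rewrite mulrAC EFinM -NE; exact: potential_int.
have theta0 : 0 < theta by case/andP: theta01.
have := besov_double_integral_le p1 theta0 Q0 C0 c0 nu_upper nu_lower E1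
  (ltW K0) q01 mS S0 iS dT.
move=> h; rewrite /besov_norm.
apply: (@le_trans _ _ ((Kb * fine N)%:E `^ p^-1)%E).
  apply: gt0_ler_poweR; rewrite ?invr_ge0 ?(ltW p0) ?in_itv/= ?leey ?andbT//.
  - apply: integral_ge0 => x _; apply: integral_ge0 => y _.
    rewrite mule_ge0 ?lee_fin ?powR_ge0// inve_ge0 mule_ge0// lee_fin.
    exact: powR_ge0.
  - by rewrite lee_fin mulr_ge0.
  - apply: (le_trans h); rewrite lee_fin /Kb le_eqVlt; apply/orP; left.
    by apply/eqP; ring.
by rewrite EFinM poweRM// -NE.
Qed.

Let Lp_le : exists2 K, 0 <= K & forall u g, sobolev mu B p u g ->
  (Lp_norm nu E p (T u) `^ p <= K%:E * N1p_norm mu B p u g `^ p)%E.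
Proof.
have [K K0 hK] := trace_op_pointwise mB p1 theta01 s0 Cm1 Cp0 codim poincare.
have [K' K'0 hK'] := dyadic_average_powR_le mB p1 Cm1 codim.
have nuE : nu setT = (fine (nu setT))%:E by rewrite fineK// ge0_fin_numE.
(* [k1] comes from the level-0 average, bounded uniformly on [E] and integrated against the finite
   measure [nu]; [k2] comes from the integral of the level-0 potential. *)
pose k1 := 2 `^ p * K' * fine (nu setT).
pose k2 := K * rad 0 `^ (theta * p) * A0.
have k10 : 0 <= k1 by rewrite mulr_ge0 ?fine_ge0// mulr_ge0 ?powR_ge0.
have Kr0 : 0 <= K * rad 0 `^ (theta * p) by rewrite mulr_ge0 ?powR_ge0 ?ltW.
have k20 : 0 <= k2 by rewrite mulr_ge0.
exists (k1 + k2); first exact: addr_ge0.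
move=> u g ug; have [up _ gp] := ug; have [_ T0 _] := hK _ _ ug.
have S0 x := @potential_ge0 R n mu B p theta s (eucl_norm \o g) 0 x.
have mS : measurable_fun setT (S (eucl_norm \o g) 0).
  exact: (measurable_potential mu theta s (Lp_measurable gp) p0).
set M := (\int[mu]_(z in B) (`|u z| `^ p)%:E)%E.
set N := (\int[mu]_(z in B) (`|(eucl_norm \o g) z| `^ p)%:E)%E.
have M0 : (0 <= M)%E by apply: integral_ge0 => z _; rewrite lee_fin powR_ge0.
have N0 : (0 <= N)%E by apply: integral_ge0 => z _; rewrite lee_fin powR_ge0.
have a0 : (0 <= (2 `^ p * K')%:E * M)%E.
  by apply: mule_ge0 M0; rewrite lee_fin mulr_ge0 ?powR_ge0.
rewrite Lp_norm_powR.
apply: (@le_trans _ _ (\int[nu]_x ((2 `^ p * K')%:E * M +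
    (K * rad 0 `^ (theta * p))%:E * S (eucl_norm \o g) 0 x))%E).
  apply: le_integral_subset => [//|x _|x _|x].
  - by rewrite lee_fin powR_ge0.
  - by apply: adde_ge0 => //; apply: mule_ge0 => //; rewrite lee_fin.
  - move=> Ex; apply: (le_trans (T0 _ Ex)); rewrite leeD2r// !EFinM -muleA.
    by rewrite lee_wpmul2l ?lee_fin ?powR_ge0//; exact: hK'.
have KS0 x : (0 <= (K * rad 0 `^ (theta * p))%:E * S (eucl_norm \o g) 0 x)%E.
  by apply: mule_ge0 => //; rewrite lee_fin.
rewrite ge0_integralD//; last exact: measurable_funeM.
rewrite (integral_cst nu measurableT ((2 `^ p * K')%:E * M)%E).
rewrite (ge0_integralZl nu measurableT mS (fun x _ => S0 x)) ?lee_fin//.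
apply: (@le_trans _ _ (k1%:E * M + k2%:E * N)%E).
  apply: leeD; last first.
    rewrite /k2 (EFinM _ A0) -muleA.
    apply: lee_wpmul2l; first by rewrite lee_fin.
    by have := potential_int 0 gp; rewrite expr0 mulr1.
  rewrite muleAC; apply: (lee_wpmul2r M0).
  by rewrite /k1 (EFinM _ (fine _)) -nuE; exact: lexx.
rewrite EFinD ge0_muleDl ?lee_fin//.
have nle f : (Lp_norm mu B p f <= N1p_norm mu B p u g ->
    \int[mu]_(z in B) (`|f z| `^ p)%:E <= N1p_norm mu B p u g `^ p)%E.
  move=> h; rewrite -Lp_norm_powR; apply: gt0_ler_poweR => //.
  - exact: ltW.
  - by rewrite in_itv/= leey Lp_norm_ge0.
  - by rewrite in_itv/= leey adde_ge0// Lp_norm_ge0.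
apply: leeD; apply: lee_wpmul2l; rewrite ?lee_fin//; apply: nle.
- by rewrite leeDl// Lp_norm_ge0.
- by rewrite leeDr// Lp_norm_ge0.
Qed.

Theorem trace_theorem : exists (K : R) (T : ('rV[R]_n -> R) -> ('rV[R]_n -> R)),
  1 <= K /\
  (forall u, N1p mu B p u -> besov nu E p theta (T u)) /\
  (forall u v, N1p mu B p u -> N1p mu B p v ->
    {ae mu, forall x, B x -> u x = v x} ->
    {ae nu, forall x, E x -> T u x = T v x}) /\
  (forall (a : R) u v, N1p mu B p u -> N1p mu B p v ->
    {ae nu, forall x, E x -> T (fun y => a * u y + v y) x = a * T u x + T v x}) /\
  (forall u g, sobolev mu B p u g ->
    (besov_norm nu E p theta (T u) <= K%:E * Lp_norm mu B p (eucl_norm \o g))%E /\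
    (Lp_norm nu E p (T u) `^ p <= K%:E * N1p_norm mu B p u g `^ p)%E) /\
  (forall u (U : set 'rV[R]_n), N1p mu B p u -> open U -> E `<=` U ->
    eucl_lipschitz U u -> {ae nu, forall x, E x -> T u x = u x}).
Proof.
have [K1 K10 h1] := besov_le; have [K2 K20 h2] := Lp_le.
have [K K0 hK] := trace_op_pointwise mB p1 theta01 s0 Cm1 Cp0 codim poincare.
have lty u g : sobolev mu B p u g ->
    (Lp_norm mu B p u < +oo)%E /\ (Lp_norm mu B p (eucl_norm \o g) < +oo)%E.
  by case=> up _ gp; rewrite !Lp_normE; split; apply: poweR_lty; exact: Lp_lty.
exists (K1 + K2 + 1), T; split; first by rewrite lerDr addr_ge0.
split.
  move=> u [g ug]; have [uoo goo] := lty _ _ ug; have [up _ gp] := ug.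
  split; last first.
    apply: (le_lt_trans (h1 _ _ ug)); rewrite lte_mul_pinfty// lee_fin//.
  rewrite /Lp/= inE; apply/andP; split; rewrite inE/=.
    apply/(measurable_restrictT _ mE); apply: measurable_funTS.
    exact: measurable_trace_op (Lp_measurable up).
  apply: (@lty_poweRy _ _ p); first by rewrite gt_eqF.
  apply: (le_lt_trans (h2 _ _ ug)); rewrite lte_mul_pinfty ?lee_fin//.
  by apply: poweR_lty; rewrite lte_add_pinfty.
split.
  move=> u v [gu [up _ _]] [gv [vp _ _]] uv; apply: aeW => x _.
  by rewrite (trace_op_ae_eq mB (Lp_measurable up) (Lp_measurable vp) uv).
split.
  move=> a u v [gu ugu] [gv vgv].
  have [up _ gup] := ugu; have [vp _ gvp] := vgv.
  have [cu _ _] := hK _ _ ugu; have [cv _ _] := hK _ _ vgv.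
  apply: filterS2 (potential_lty gup) (potential_lty gvp) => x Su Sv Ex.
  exact: (trace_op_linear mB p1 codim a Ex up vp (cu _ Ex Su) (cv _ Ex Sv)).
split.
  move=> u g ug; split.
    apply: (le_trans (h1 _ _ ug)); rewrite lee_wpmul2r ?Lp_norm_ge0//.
    by rewrite lee_fin -addrA lerDl addr_ge0.
  apply: (le_trans (h2 _ _ ug)); rewrite lee_wpmul2r ?poweR_ge0//.
  by rewrite lee_fin addrAC lerDr addr_ge0.
move=> u U [g [up _ _]] oU EU uL; apply: aeW => x Ex.
exact: (trace_op_lipschitz mB p1 Cm1 codim up oU EU uL Ex).
Qed.

End trace_theorem.

(** * Reduction to sigma-finite measures and to estimates at points of E *)

Theorem theorem5p3 (R : realType) (n : nat) (Q p theta alpha : R)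
    (x0 : 'rV[R]_n) (rho : R) (E : set 'rV[R]_n)
    (nu mu : {measure set 'rV[R]_n -> \bar R}) :
  let B := eucl_ball x0 rho in
  0 < Q < n%:R ->
  0 < rho ->
  compact E -> E `<=` eucl_ball x0 (rho / 2) -> (eucl_diam E <= 1)%E ->
  ahlfors_regular Q E ->
  (forall A, measurable A -> nu A = hausdorff Q (A `&` E)) ->
  1 < p -> 0 < theta < 1 -> p * theta < 1 ->
  alpha <= 0 -> 0 < alpha + n%:R - Q ->
  theta < 1 - (alpha + n%:R - Q) / p ->
  weighted_measure B mu ->
  codim_regular B E mu (n%:R + alpha) ->
  doubling_on B mu ->
  (forall q, 1 < q -> poincare_on B mu q) ->
  exists (C : R) (T : ('rV[R]_n -> R) -> ('rV[R]_n -> R)),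
    1 <= C /\
    (* T maps N^{1,p}(B, mu) to the Besov space, is compatible with equality
       almost everywhere, and is linear *)
    (forall u, N1p mu B p u -> besov nu E p theta (T u)) /\
    (forall u v, N1p mu B p u -> N1p mu B p v ->
      {ae mu, forall x, B x -> u x = v x} ->
      {ae nu, forall x, E x -> T u x = T v x}) /\
    (forall (a : R) u v, N1p mu B p u -> N1p mu B p v ->
      {ae nu, forall x, E x -> T (fun y => a * u y + v y) x = a * T u x + T v x}) /\
    (forall u g, sobolev mu B p u g ->
      (besov_norm nu E p theta (T u) <= C%:E * Lp_norm mu B p (eucl_norm \o g))%E /\
      (Lp_norm nu E p (T u) `^ p <= C%:E * N1p_norm mu B p u g `^ p)%E) /\
    (forall u (U : set 'rV[R]_n), N1p mu B p u -> open U -> E `<=` U -> eucl_lipschitz U u ->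
      {ae nu, forall x, E x -> T u x = u x}).
Proof.
move=> B /andP[Q0 Qn] rho0 cE EB E1 aE nuE p1 theta01 _ _ alpha0 theta_lt wB
  codim _ poincare.
have mB : measurable B by exact: measurable_eucl_ball.
have EsubB : E `<=` B.
  move=> x /EB xE; apply: lt_trans xE _.
  by rewrite ltr_pdivrMr// ltr_pMr// ltr1n.
have [C C0 nu_upper] := ahlfors_upper Q0 cE E1 aE nuE.
have [c c0 nu_lower] := ahlfors_lower aE nuE.
have nu_fin := ahlfors_finite Q0 cE E1 aE nuE.
have nu_sf : sigma_finite setT nu.
  by apply: fin_num_fun_sigma_finite; [rewrite measure0|exact: lty_fin_num_fun].
have [mu' muE] := sigma_finite_measure_ex (weighted_measure_sigma_finite mB wB).
have [nu' nu'E] := sigma_finite_measure_ex nu_sf.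
subst mu nu.
have [Cm Cm1 hm] := codim; have [Cp Cp1 hp] := poincare _ p1.
have p0 : 0 < p by exact: lt_trans p1.
apply: (@trace_theorem _ _ mu' nu' B E p theta (n%:R + alpha) Q Cm Cp C c) => //.
- exact: compact_measurable_rV.
- lra.
(* The upper bound on [theta], multiplied by p, is the positivity of delta. *)
- move: theta_lt; rewrite -(ltr_pM2r p0) mulrBl divfK ?gt_eqF//.
  by rewrite mulrBl; lra.
- by rewrite ltW// (lt_trans _ Cp1).
- exact: ltW.
(* A point of [E] has distance 0 to [E], so every radius in (0, 2) is admissible. *)
- move=> x r Ex /andP[r0 r2]; apply: hm; rewrite ?r0//; first exact: EsubB.
  apply: (@le_lt_trans _ _ 0%E); last by rewrite lte_fin.
  apply: mule_ge0_le0; first by rewrite lee_fin invr_ge0.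
  by apply: ereal_inf_lbound; exists x => //; rewrite eucl_distxx.
- move=> f g fg x r Ex /andP[r0 r2]; apply: hp => //.
    by rewrite r0/= ltW// (lt_le_trans r2)// ler_nat.
  by exists x; split; [exact: eucl_ball_center|exact: EsubB].
- move=> x y Ex Ey; rewrite -lee_fin; apply: le_trans E1.
  exact: le_eucl_diam.
Qed.
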